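(* Let $d \ge 1$ be an integer, let $1 < p \le 2$ and let $p' < r \le \infty$. Then there exists a sequence of (nonzero) Schwartz functions $f_n \in X_d$ such that $$\lim_{n \to \infty} \frac{\|f_n\|_{r}}{\|f_n\|_p} = \infty .$$
   Context: Norms are $L^p(\mathbb{R}^d)$ norms of complex-valued functions; $p'$ is the conjugate exponent, $\frac1p+\frac1{p'}=1$. The space $X_d$ consists of the functions in $L^1(\mathbb{R}^d)$ whose Fourier transforms vanish on all spheres (centered at the origin) of radius $\sqrt{m_1^2+\dots+m_d^2}$ with $m_i$ integers: $$X_d = \{ f \in L^1(\mathbb{R}^d) : \hat f(\mathbf{r}) = 0 \text{ whenever } |\mathbf{r}| = \sqrt{m_1^2+\dots+m_d^2} \text{ for some } (m_1,\dots,m_d) \in \mathbb{Z}^d \},$$ where $\hat f(\xi) = \int_{\mathbb{R}^d} f(x) e^{-2\pi i x\cdot\xi}\,dx$. *)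

(* Defs.v *)
From HB Require Import structures.
From mathcomp Require Import all_boot all_order all_algebra.
From mathcomp Require Import complex.
From mathcomp Require Import all_classical all_reals all_analysis.

Set Implicit Arguments.
Unset Strict Implicit.
Unset Printing Implicit Defensive.

Import Order.TTheory GRing.Theory Num.Theory.
Import numFieldNormedType.Exports.
Import ComplexField.Normc.

Local Open Scope classical_set_scope.
Local Open Scope ring_scope.

(* R^n is 'rV[R]_n, with the product sigma-algebra of the Borel sigma-algebra
   of R, i.e. the one generated by the coordinate functions; it is the Borel
   sigma-algebra of R^n. *)
Definition measure_rV_display : measure_display -> measure_display.
Proof. exact. Qed.

Section measurable_rV.
Context {R : realType} {n : nat}.

Definition coord_rV (i : 'I_n) (x : 'rV[R]_n) : R := x ord0 i.

Let rV_set0 : g_sigma_preimage coord_rV set0.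
Proof. exact: sigma_algebra0. Qed.

Let rV_setC A : g_sigma_preimage coord_rV A -> g_sigma_preimage coord_rV (~` A).
Proof. exact: sigma_algebraC. Qed.

Let rV_bigcup (F : (set 'rV[R]_n)^nat) :
  (forall i, g_sigma_preimage coord_rV (F i)) ->
  g_sigma_preimage coord_rV (\bigcup_i (F i)).
Proof. exact: sigma_algebra_bigcup. Qed.

HB.instance Definition _ := @isMeasurable.Build
  (measure_rV_display default_measure_display)
  'rV[R]_n (g_sigma_preimage coord_rV) rV_set0 rV_setC rV_bigcup.

Lemma measurable_coord_rV (i : 'I_n) :
  measurable_fun [set: 'rV[R]_n] (coord_rV i).
Proof.
move=> _ Y mY; rewrite setTI; apply: sub_sigma_algebra => /=.
rewrite -bigcup_seq/=; exists i => /=; first by rewrite mem_index_enum.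
by exists Y => //; rewrite setTI.
Qed.

Lemma measurable_fun_rVP d (T : measurableType d) (f : T -> 'rV[R]_n) :
  measurable_fun [set: T] f <->
  forall i, measurable_fun [set: T] (coord_rV i \o f).
Proof.
split=> [mf i|mf]; first exact: measurableT_comp (measurable_coord_rV i) mf.
have sub : g_sigma_preimage coord_rV `<=` [set B | measurable (f @^-1` B)].
  apply: smallest_sub.
    split=> [|A mA|F mF] /=.
    - by rewrite preimage_set0.
    - by rewrite setTD -preimage_setC; exact: measurableC.
    - by rewrite preimage_bigcup; exact: bigcupT_measurable.
  rewrite -bigcup_seq => A [i _ [B mB <-]] /=.
  by rewrite setTI -comp_preimage -[X in measurable X]setTI; exact: mf.
by move=> _ B mB; rewrite setTI; exact: sub.
Qed.

End measurable_rV.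

(* Lebesgue measure on R^n: dirac mass on the one-point space R^0, and the
   product measure under R^(n+1) = R * R^n. *)
Section lebesgue_rV_step.
Context {R : realType} {n : nat}.

Definition cons_rV (z : R * 'rV[R]_n) : 'rV[R]_n.+1 :=
  row_mx (const_mx z.1 : 'rV_1) z.2.

Lemma coord_cons_rV0 z : coord_rV ord0 (cons_rV z) = z.1.
Proof.
by rewrite /coord_rV mxE; case: splitP => // j _; rewrite mxE.
Qed.

Lemma coord_cons_rVS z (i : 'I_n) :
  coord_rV (lift ord0 i) (cons_rV z) = coord_rV i z.2.
Proof.
rewrite /coord_rV mxE; case: splitP => [j|j [ji]]; first by case: j => -[].
by congr (z.2 _ _); exact: val_inj.
Qed.

Lemma measurable_cons_rV : measurable_fun [set: R * 'rV[R]_n] cons_rV.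
Proof.
apply/measurable_fun_rVP => i; have [j ->|->] := unliftP ord0 i.
  rewrite (_ : _ \o _ = coord_rV j \o snd); last first.
    by apply/funext => z /=; rewrite coord_cons_rVS.
  exact: measurableT_comp (measurable_coord_rV j) measurable_snd.
rewrite (_ : _ \o _ = fst); first exact: measurable_fst.
by apply/funext => z /=; rewrite coord_cons_rV0.
Qed.

Definition uncons_rV (x : 'rV[R]_n.+1) : R * 'rV[R]_n :=
  (coord_rV ord0 x, \row_i coord_rV (lift ord0 i) x).

Lemma cons_rVK : cancel cons_rV uncons_rV.
Proof.
move=> z; rewrite /uncons_rV coord_cons_rV0 [RHS]surjective_pairing.
by congr pair; apply/rowP => i; rewrite mxE coord_cons_rVS.
Qed.

Lemma measurable_uncons_rV : measurable_fun [set: 'rV[R]_n.+1] uncons_rV.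
Proof.
apply/measurable_fun_pairP; split; first exact: measurable_coord_rV.
apply/measurable_fun_rVP => i.
rewrite (_ : _ \o _ = coord_rV (lift ord0 i)); first exact: measurable_coord_rV.
by apply/funext => x; rewrite /= {1}/coord_rV mxE.
Qed.

Variable mu : {sigma_finite_measure set 'rV[R]_n -> \bar R}.

Definition lebesgue_step : set 'rV[R]_n.+1 -> \bar R :=
  pushforward (lebesgue_measure \x mu)%E cons_rV.

Let step0 : lebesgue_step set0 = 0%E.
Proof. by rewrite /lebesgue_step /pushforward preimage_set0 measure0. Qed.

Let step_ge0 A : (0 <= lebesgue_step A)%E.
Proof. by rewrite /lebesgue_step /pushforward measure_ge0. Qed.

Let step_sigma_additive : semi_sigma_additive lebesgue_step.
Proof.
move=> F mF tF mUF; rewrite /lebesgue_step /pushforward preimage_bigcup.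
apply: measure_semi_sigma_additive.
- by move=> i; rewrite -[X in measurable X]setTI; exact: measurable_cons_rV.
- apply/trivIsetP => /= i j _ _ ij; rewrite -preimage_setI.
  by move/trivIsetP : tF => /(_ _ _ _ _ ij) ->//; rewrite preimage_set0.
- rewrite -preimage_bigcup -[X in measurable X]setTI.
  exact: measurable_cons_rV.
Qed.

HB.instance Definition _ := isMeasure.Build _ _ _ lebesgue_step
  step0 step_ge0 step_sigma_additive.

Let step_sigma_finite : sigma_finite [set: 'rV[R]_n.+1] lebesgue_step.
Proof.
have /sigma_finiteP[F [FT ndF Foo]] := sigma_finiteT (@lebesgue_measure R).
have /sigma_finiteP[G [GT ndG Goo]] := sigma_finiteT mu.
exists (fun k => uncons_rV @^-1` (F k `*` G k)).
  rewrite -preimage_bigcup -(preimage_setT uncons_rV); congr (_ @^-1` _).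
  rewrite -setXTT FT GT predeqE => -[x y]; split.
    move=> [/= [k _ Fkx] [l _ Gly]]; exists (maxn k l) => //; split.
    - by move: x Fkx; exact/subsetPset/ndF/leq_maxl.
    - by move: y Gly; exact/subsetPset/ndG/leq_maxr.
  by move=> [k _ []/= ? ?]; split; exists k.
move=> k; have [mF Fkoo] := Foo k; have [mG Gkoo] := Goo k; split.
  rewrite -[X in measurable X]setTI; apply: measurable_uncons_rV => //.
  exact: measurableX.
rewrite /lebesgue_step /pushforward -comp_preimage.
rewrite (_ : _ \o _ = id); last by apply/funext => z; exact: cons_rVK.
by rewrite preimage_id product_measure1E// lte_mul_pinfty// ge0_fin_numE.
Qed.

HB.instance Definition _ := Measure_isSigmaFinite.Build _ _ _ lebesgue_step
  step_sigma_finite.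

End lebesgue_rV_step.

Fixpoint lebesgue_rV (R : realType) (n : nat) :
    {sigma_finite_measure set 'rV[R]_n -> \bar R} :=
  if n is n'.+1 then lebesgue_step (lebesgue_rV R n')
  else dirac (0 : 'rV[R]_0).
Arguments lebesgue_rV {R} n.

Lemma lebesgue_rVS (R : realType) (n : nat) (A : set 'rV[R]_n.+1) :
  lebesgue_rV n.+1 A =
  (lebesgue_measure \x lebesgue_rV n)%E (cons_rV @^-1` A).
Proof. by []. Qed.

(* Characterizes lebesgue_rV n among measures: boxes have the expected volume. *)
Lemma lebesgue_rV_box (R : realType) (n : nat) (A : 'I_n -> set R) :
  (forall i, measurable (A i)) ->
  lebesgue_rV n [set x : 'rV[R]_n | forall i, A i (x ord0 i)] =
  (\prod_(i < n) lebesgue_measure (A i))%E.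
Proof.
elim: n A => [|n ih] A mA.
  by rewrite big_ord0 /= diracE mem_set// => -[].
pose B := [set x : 'rV[R]_n | forall i, A (lift ord0 i) (x ord0 i)].
have mB : measurable B.
  rewrite (_ : B = \bigcap_(i in [set: 'I_n])
      (coord_rV i @^-1` A (lift ord0 i))).
    apply: fin_bigcap_measurable => // i _.
    by rewrite -[X in measurable X]setTI; exact: measurable_coord_rV.
  by apply/seteqP; split => [x xA i _|x xA i]; [exact: xA|exact: (xA i)].
rewrite big_ord_recl -ih//.
transitivity ((lebesgue_measure \x lebesgue_rV n)%E (A ord0 `*` B)); last first.
  exact: (product_measure1E lebesgue_measure (lebesgue_rV n) (mA ord0) mB).
rewrite lebesgue_rVS; congr product_measure1.
apply/seteqP; split => [z /= zA|z /= [z1 z2] i].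
  split; first by have := zA ord0; rewrite -/(coord_rV _ _) coord_cons_rV0.
  move=> i; have := zA (lift ord0 i).
  by rewrite -/(coord_rV _ _) coord_cons_rVS.
rewrite -/(coord_rV _ _); have [j ->|->] := unliftP ord0 i.
  by rewrite coord_cons_rVS; exact: z2.
by rewrite coord_cons_rV0.
Qed.

Section fourier.
Context {R : realType} {d : nat}.
Implicit Types (f : 'rV[R]_d -> R[i]) (x xi : 'rV[R]_d).

Definition cLnorm (q : \bar R) f : \bar R :=
  Lnorm (lebesgue_rV d) q (fun x => (normc (f x))%:E).

Definition cintegrable f : Prop :=
  (lebesgue_rV d).-integrable setT (fun x => (complex.Re (f x))%:E) /\
  (lebesgue_rV d).-integrable setT (fun x => (complex.Im (f x))%:E).

Definition cintegral f : R[i] :=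
  Complex (\int[lebesgue_rV d]_x complex.Re (f x))
          (\int[lebesgue_rV d]_x complex.Im (f x)).

Definition dotrV x xi : R := \sum_(i < d) x ord0 i * xi ord0 i.

(* The Euclidean norm; the library norm `|x| on 'rV[R]_d is the sup norm. *)
Definition eucl_norm x : R := Num.sqrt (\sum_(i < d) x ord0 i ^+ 2).

Definition expi (t : R) : R[i] := Complex (cos t) (sin t).

Definition fourier f xi : R[i] :=
  cintegral (fun x => f x * expi (- (2 * pi * dotrV x xi))).

Definition X_space : set ('rV[R]_d -> R[i]) :=
  [set f | cintegrable f /\
    forall (xi : 'rV[R]_d) (m : 'I_d -> int),
      eucl_norm xi = Num.sqrt (\sum_(i < d) (m i)%:~R ^+ 2) ->
      fourier f xi = 0].

Definition cpartial (i : 'I_d) f : 'rV[R]_d -> R[i] := fun x =>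
  Complex ('D_(delta_mx ord0 i) (fun y => complex.Re (f y)) x)
          ('D_(delta_mx ord0 i) (fun y => complex.Im (f y)) x).

(* Iterated partial derivatives are indexed by words in the coordinates. *)
Definition cpartials (s : seq 'I_d) f : 'rV[R]_d -> R[i] :=
  foldr cpartial f s.

Definition smooth f : Prop := forall s : seq 'I_d,
  continuous (fun x => complex.Re (cpartials s f x)) /\
  continuous (fun x => complex.Im (cpartials s f x)) /\
  forall (i : 'I_d) (x : 'rV[R]_d),
    derivable (fun y => complex.Re (cpartials s f y)) x (delta_mx ord0 i) /\
    derivable (fun y => complex.Im (cpartials s f y)) x (delta_mx ord0 i).

Definition schwartz f : Prop :=
  smooth f /\
  forall (a : 'I_d -> nat) (s : seq 'I_d), exists M : R, forall x,
    normc ((\prod_(i < d) x ord0 i ^+ a i)%:C%C * cpartials s f x) <= M.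

End fourier.

(* Main.v *)
Require Import Defs.
From HB Require Import structures.
From mathcomp Require Import all_boot all_order all_algebra.
From mathcomp Require Import complex.
From mathcomp Require Import all_classical all_reals all_analysis.
From mathcomp Require Import measurable_realfun ring lra.

Set Implicit Arguments.
Unset Strict Implicit.
Unset Printing Implicit Defensive.

Import Order.TTheory GRing.Theory Num.Theory.
Import numFieldNormedType.Exports.

Local Open Scope classical_set_scope.
Local Open Scope ring_scope.

(** Sums of squares of integers are nonnegative integers, so it is enough that
    the Fourier transform of [f] vanish whenever [|xi|^2] is an integer. The
    multiplier [1 - exp(- 2 i pi |xi|^2)] does; applied to a function [g], it
    subtracts from [g] its evolution under the free Schroedinger flow at one
    fixed time. Let [g] be the Gaussian of width [eps] and height [1],

      [g x = exp(- |x|^2 / eps^2)].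

    Its evolution is again a Gaussian, now complex: in modulus it has height
    of order [eps^d] and width of order [1/eps]. Writing [p'] for the exponent
    conjugate to [p], the [L^p] norms of [g] and of its evolution are of order
    [eps^(d/p)] and [eps^(d - d/p) = eps^(d/p')], and the second dominates since
    [p <= 2]. On the cube of side [2 eps] the evolution is negligible, so that
    the [L^r] norm of the difference is at least of order [eps^(d/r)]. The ratio
    is therefore at least of order [eps^(d/r - d/p')], which tends to infinity
    with [1/eps] as [r > p'].

    Explicitly, the difference is

      [f x = exp(- w1 |x|^2) - k exp(- w2 |x|^2)],

    [1/w1 = eps^2] and [1/w2 = eps^2 + 2i/pi] ([concentrated]). With
    [G w = \int exp(- w t^2) dt] ([gauss_int]), the Fourier transform of
    [exp(- w |x|^2)] is [G w ^ d * exp(- pi^2 |xi|^2 / w)] ([fourier_gaussian]),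
    so that [k = (G w1 / G w2) ^ d] gives the required zeros
    ([fourier_concentrated]). Only the size of [k]
    matters for the norms, and it follows from [|G w|^2 * |w| = pi]
    ([normc_gauss_int]). This identity and the one-dimensional transform are
    both consequences of linear differential equations, satisfied by the
    integrals of [exp(- u t^2)] against [cos (y t + v t^2)] and
    [sin (y t + v t^2)] as functions of [y] and [v]; the equations come from
    differentiation under the integral sign and integration by parts
    ([is_derive_osc_moment_freq], [is_derive_osc_moment_chirp],
    [osc_moment_rec]). The norms are estimated in [cLnorm_ge] and
    [cLnorm_concentrated_le]. *)

(** * Integrals of oscillating functions of one variable *)

Section oscillatory_integral.
Context d (T : measurableType d) (R : realType).
Variable mu : {measure set T -> \bar R}.
Implicit Types (m k l : T -> R) (g h : R -> R).

Lemma integrable_mul_bounded (m g : T -> R) :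
  measurable_fun setT g -> (forall x, `|g x| <= 1) ->
  mu.-integrable setT (EFin \o m) ->
  mu.-integrable setT (EFin \o (fun x => m x * g x)).
Proof.
move=> mg g1 im; have mm := measurable_int _ im.
apply: (le_integrable _ _ _ im) => //.
  by apply/measurable_EFinP/measurable_funM => //; exact/measurable_EFinP.
by move=> x _; rewrite lee_fin normrM ler_piMr.
Qed.

(** The profile [g] is kept abstract so that one proof serves for both [cos] and
    [sin]; dominated differentiation applies since the derivative in [s] is
    bounded by the integrable function [m * k]. *)
Lemma is_derive_integral_osc g h m k l (t : R) :
  (forall y : R, is_derive y (1 : R) g (h y)) ->
  (forall y, `|g y| <= 1) -> (forall y, `|h y| <= 1) ->
  measurable_fun setT k -> measurable_fun setT l ->
  mu.-integrable setT (EFin \o m) ->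
  mu.-integrable setT (EFin \o (fun x => m x * k x)) ->
  is_derive t (1 : R) (fun s => \int[mu]_x (m x * g (s * k x + l x)))
    (\int[mu]_x (m x * k x * h (t * k x + l x))).
Proof.
move=> dg g1 h1 mk ml im imk.
have It : `]t - 1, t + 1[%classic t by rewrite /= in_itv/=; apply/andP; split; lra.
have mphase s : measurable_fun setT (fun x => s * k x + l x).
  by apply: measurable_funD => //; exact: measurable_funM.
have mg : measurable_fun setT g.
  apply: continuous_measurable_fun => y; apply: differentiable_continuous.
  by apply/derivable1_diffP; have [] := dg y.
have intf (s : R) : `]t - 1, t + 1[%classic s ->
    mu.-integrable setT (EFin \o (fun x => m x * g (s * k x + l x))).
  by move=> _; apply: integrable_mul_bounded => //; exact: measurableT_comp.
have der (s : R) x : is_derive s (1 : R) (fun s => m x * g (s * k x + l x))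
    (m x * k x * h (s * k x + l x)).
  apply: is_derive_eq; rewrite /GRing.scale/=; ring.
have derf (s : R) x : `]t - 1, t + 1[%classic s -> setT x ->
    derivable ((fun s x => m x * g (s * k x + l x)) ^~ x) s 1.
  by move=> _ _; have [] := der s x.
have G_ub (s : R) x : `]t - 1, t + 1[%classic s -> setT x ->
   `|partial1of2 (fun s x => m x * g (s * k x + l x)) s x| <= `|m x * k x|.
  move=> _ _; rewrite partial1of2E; have [_ ->] := der s x.
  by rewrite normrM ler_piMr.
have iG : mu.-integrable setT (EFin \o (fun x => `|m x * k x|)).
  exact: integrable_norm imk.
have G0 x : 0 <= `|m x * k x| by [].
apply: DeriveDef.
  exact: (derivable_under_integral measurableT It intf derf G0 iG G_ub).
rewrite -derive1E (differentiation_under_integral measurableT It intf derf G0 iG G_ub).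
apply: eq_Rintegral => x _.
rewrite -/(partial1of2 (fun s x => m x * g (s * k x + l x)) t x) partial1of2E.
by have [_ ->] := der t x.
Qed.

End oscillatory_integral.

Section line_integral.
Context {R : realType}.
Local Notation mu := (@lebesgue_measure R).

(** From [- n] to [n] the integral is [F n - F (- n)], which is [O(1/n)] by the
    decay of [F], and these integrals converge to the one over the line. *)
Lemma Rintegral_derivative_eq0 (F f : R -> R) (K : R) :
  continuous f -> (forall x, is_derive x (1 : R) F (f x)) ->
  (forall x, `|F x| * `|x| <= K) ->
  mu.-integrable setT (EFin \o f) -> \int[mu]_x f x = 0.
Proof.
move=> cf dF FK fi.
have mf : measurable_fun setT f by exact: continuous_measurable_fun.
have cF : continuous F.
  move=> x; apply: differentiable_continuous; apply/derivable1_diffP.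
  by have [] := dF x.
pose D n : set R := `[- n.+1%:R, n.+1%:R]%classic.
have : ((fun n => \int[mu]_x (f x * \1_(D n) x)) @ \oo --> \int[mu]_x f x)%R.
  have [||||| _ _] := @dominated_convergence _ _ R mu setT measurableT
    (fun n x => (f x * \1_(D n) x)%:E) (EFin \o f) (EFin \o (fun x => `|f x|)).
  - move=> n; apply/measurable_EFinP; apply: measurable_funM => //.
    by apply: measurable_indic; exact: measurable_itv.
  - by apply/measurable_EFinP.
  - apply: aeW => x _ /=; apply: cvg_EFin; first exact: nearW.
    apply: cvg_near_cst.
    exists (Num.truncn `|x|) => // n /= xn.
    rewrite /= indicE mem_set ?mulr1// /D /= in_itv/= -ler_norml.
    apply: le_trans (ltW (truncnS_gt _)) _; by rewrite ler_nat.
  - exact: integrable_norm fi.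
  - apply: aeW => x n _; rewrite lee_fin normrM ler_piMr//.
    by rewrite indicE; case: (_ \in _); rewrite ?normr1 ?normr0.
  have fin := integrable_fin_num measurableT fi.
  by move=> h; apply: fine_cvg; rewrite fineK.
suff : ((fun n => \int[mu]_x (f x * \1_(D n) x)) @ \oo --> (0:R)).
  by move=> h1 h2; exact: cvg_unique h2 h1.
have intD n : \int[mu]_x (f x * \1_(D n) x) = F n.+1%:R - F (- n.+1%:R).
  rewrite /Rintegral (_ : \int[mu]_x (f x * \1_(D n) x)%:E = \int[mu]_(x in D n) (f x)%:E)%E.
    rewrite (@continuous_FTC2 _ f F)//.
    - by rewrite (@lt_trans _ _ 0)// ?oppr_lt0 ltr0n.
    - exact: continuous_subspaceT.
    - split.
      + by move=> x _; have [] := dF x.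
      + by apply: cvg_at_right_filter; exact: cF.
      + by apply: cvg_at_left_filter; exact: cF.
    - by move=> x _; rewrite derive1E; have [] := dF x.
  rewrite [RHS]integral_mkcond; apply: eq_integral => x _.
  by rewrite restrict_EFin/= patchE indicE; case: (_ \in _); rewrite ?mulr1 ?mulr0.
have bnd n (s : R) : `|s| = n.+1%:R -> `|F s| <= K * n.+1%:R^-1.
  by move=> sn; rewrite ler_pdivlMr// -sn.
apply/cvgrPdist_le => e e0.
have : ((fun n : nat => 2 * K * n.+1%:R^-1) @ \oo --> (2 * K * 0 : R)).
  by apply: cvgMr; exact: cvg_harmonic.
rewrite mulr0 => /cvgrPdist_le/(_ e e0); apply: filterS => n.
rewrite !sub0r !normrN => h; apply: le_trans h.
rewrite intD (le_trans (ler_normB _ _))// (le_trans _ (ler_norm _))//.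
have := bnd n n.+1%:R (normr_nat _ _); have := bnd n (- n.+1%:R).
rewrite normrN normr_nat => /(_ erefl) h1 h2.
by rewrite -mulrA mulr_natl mulr2n lerD.
Qed.

End line_integral.

(** * Real Gaussians and their moments *)

Section gaussian_moments.
Context {R : realType}.
Local Notation mu := (@lebesgue_measure R).

Lemma norm_le_expR_sqr (c : R) : 0 < c ->
  exists2 K : R, 0 <= K & forall t : R, `|t| <= K * expR (c * t ^+ 2).
Proof.
move=> c0; exists (1 + c^-1) => [|t]; first by rewrite addr_ge0 ?invr_ge0 ?ltW.
apply: (@le_trans _ _ ((1 + c^-1) * (1 + c * t ^+ 2))); last first.
  by rewrite ler_wpM2l ?expR_ge1Dx// addr_ge0 ?invr_ge0 ?ltW.
have -> : (1 + c^-1) * (1 + c * t ^+ 2) = 1 + t ^+ 2 + (c^-1 + c * t ^+ 2).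
  by field; rewrite gt_eqF.
have h : 0 <= c^-1 + c * t ^+ 2.
  by rewrite addr_ge0 ?invr_ge0 ?(ltW c0)// mulr_ge0 ?sqr_ge0 ?(ltW c0).
apply: le_trans (_ : 1 + t ^+ 2 <= _); last by rewrite lerDl.
by rewrite -real_normK ?num_real//; have := sqr_ge0 (`|t| - 1); nra.
Qed.

(** Half of the exponent is spent on each factor [x], which is why the final
    rate [c] depends on [n]. *)
Lemma gauss_moment_le n (u : R) : 0 < u ->
  exists c K : R, [/\ 0 < c, 0 <= K &
    forall x, `|x ^+ n * expR (- (u * x ^+ 2))| <= K * expR (- (c * x ^+ 2))].
Proof.
elim: n u => [|n ih] u u0.
  by exists u, 1; split => // x; rewrite expr0 !mul1r ger0_norm ?expR_ge0.
have u20 : 0 < u / 2 by lra.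
have [c [K [c0 K0 ihK]]] := ih _ u20.
have c20 : 0 < c / 2 by lra.
have [K' K'0 hK'] := norm_le_expR_sqr c20.
exists (c / 2), (K * K'); split => [//||x]; first exact: mulr_ge0.
have -> : x ^+ n.+1 * expR (- (u * x ^+ 2)) =
    x * expR (- (u / 2 * x ^+ 2)) * (x ^+ n * expR (- (u / 2 * x ^+ 2))).
  by rewrite exprS (_ : - (u * _) = - (u / 2 * x ^+ 2) + - (u / 2 * x ^+ 2)) ?expRD; [ring|field].
rewrite normrM; apply: le_trans (ler_wpM2l (normr_ge0 _) (ihK x)) _.
have -> : K * K' * expR (- (c / 2 * x ^+ 2)) =
    K' * expR (c / 2 * x ^+ 2) * (K * expR (- (c * x ^+ 2))).
  by rewrite (_ : - (c / 2 * x ^+ 2) = c / 2 * x ^+ 2 + - (c * x ^+ 2)) ?expRD; [ring|field].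
apply: ler_wpM2r; first by rewrite mulr_ge0 ?expR_ge0.
rewrite normrM; apply: le_trans (hK' x); rewrite ler_piMr// ger0_norm ?expR_ge0//.
by rewrite -[leRHS]expR0 ler_expR oppr_le0; apply: mulr_ge0 (ltW u20) (sqr_ge0 _).
Qed.

Lemma integral_expR_sqr (u : R) : 0 < u ->
  (\int[mu]_x (expR (- (u * x ^+ 2)))%:E = (Num.sqrt (pi / u))%:E)%E /\
  mu.-integrable setT (EFin \o (fun x => expR (- (u * x ^+ 2)))).
Proof.
move=> u0; pose s := Num.sqrt (2 * u)^-1.
have u20 : 0 < (2 * u)^-1 by rewrite invr_gt0 mulr_gt0.
have s0 : s != 0 by rewrite gt_eqF// sqrtr_gt0.
have p0 : normal_peak s != 0 by rewrite gt_eqF// normal_peak_gt0.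
have s2 : s ^+ 2 = (2 * u)^-1 by rewrite sqr_sqrtr// ltW.
have E : (fun x => expR (- (u * x ^+ 2))) =
    (fun x => (normal_peak s)^-1 * normal_pdf 0 s x).
  apply/funext => x; rewrite /normal_pdf (negbTE s0) mulKf//.
  by rewrite /normal_fun subr0 s2; congr expR; field; rewrite gt_eqF.
have i1 := @integrable_normal_pdf R 0 s.
have i2 : mu.-integrable setT (EFin \o (fun x => expR (- (u * x ^+ 2)))).
  rewrite E; have := integrableZl measurableT (normal_peak s)^-1 i1.
  by apply: eq_integrable => // x _; rewrite /= EFinM.
split => //.
have -> : (fun x => (expR (- (u * x ^+ 2)))%:E) =
    (fun x => (normal_peak s)^-1%:E * (normal_pdf 0 s x)%:E)%E.
  by apply/funext => x; rewrite -EFinM -[RHS](congr1 EFin (congr1 (@^~ x) E)).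
rewrite integralZl// integral_normal_pdf mule1 /normal_peak invrK s2.
by congr (Num.sqrt _)%:E; field; rewrite gt_eqF.
Qed.

Lemma integrable_gauss_moment n (u : R) : 0 < u ->
  mu.-integrable setT (EFin \o (fun x => x ^+ n * expR (- (u * x ^+ 2)))).
Proof.
move=> u0; have [c [K [c0 K0 hK]]] := gauss_moment_le n u0.
have [_ ic] := integral_expR_sqr c0.
have iK := integrableZl measurableT K ic.
apply: (le_integrable measurableT _ _ iK) => [|x _].
  apply/measurable_EFinP; apply: continuous_measurable_fun => x.
  apply: cvgM; first exact: exprn_continuous.
  apply: continuous_comp; last exact: continuous_expR.
  by apply: cvgN; apply: cvgMr; exact: exprn_continuous.
by rewrite lee_fin (le_trans (hK x))// ler_norm.
Qed.

End gaussian_moments.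

(** * Moments of Gaussians with a quadratic phase *)

Section oscillatory_moments.
Context {R : realType}.
Local Notation mu := (@lebesgue_measure R).
Variables (u : R) (u0 : 0 < u).

(** For [g = cos] this is the real part, and for [g = sin] minus the imaginary
    part, of the integral of [x ^+ n * exp(- (u + i v) x^2 - i y x)]. *)
Definition osc_moment (g : R -> R) (n : nat) (v y : R) : R :=
  \int[mu]_x (x ^+ n * expR (- (u * x ^+ 2)) * g (y * x + v * x ^+ 2)).

Lemma measurable_exprn n (c : R) : measurable_fun setT (fun x : R => c * x ^+ n).
Proof.
by apply: continuous_measurable_fun => x; apply: cvgMr; exact: exprn_continuous.
Qed.

Lemma integrable_gauss_momentM n k : mu.-integrable setT
  (EFin \o (fun x => x ^+ n * expR (- (u * x ^+ 2)) * x ^+ k)).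
Proof.
have := integrable_gauss_moment (n + k) u0.
by apply: eq_integrable => // x _ /=; congr _%:E; rewrite exprD; ring.
Qed.

Section bounded_profile.
Variables (g h : R -> R).
Hypothesis dg : forall y : R, is_derive y (1 : R) g (h y).
Hypothesis g1 : forall y, `|g y| <= 1.
Hypothesis ch : continuous h.
Hypothesis h1 : forall y, `|h y| <= 1.

Let cg : continuous g.
Proof.
by move=> y; apply: differentiable_continuous; apply/derivable1_diffP; have [] := dg y.
Qed.

Lemma integrable_osc_moment (f : R -> R) n v y :
  continuous f -> (forall y, `|f y| <= 1) -> mu.-integrable setT
  (EFin \o (fun x => x ^+ n * expR (- (u * x ^+ 2)) * f (y * x + v * x ^+ 2))).
Proof.
move=> cf f1.
apply: integrable_mul_bounded => //; last exact: integrable_gauss_moment.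
apply: measurableT_comp; first exact: continuous_measurable_fun.
by apply: measurable_funD; [exact: (measurable_exprn 1)|exact: measurable_exprn].
Qed.

Lemma is_derive_osc_moment_freq n v (y : R) :
  is_derive y (1 : R) (osc_moment g n v) (osc_moment h n.+1 v y).
Proof.
have := @is_derive_integral_osc _ _ R mu g h _ _ _ y dg g1 h1
  (measurable_exprn 1 1) (measurable_exprn 2 v) (integrable_gauss_moment n u0).
have -> : (fun x : R => x ^+ n * expR (- (u * x ^+ 2)) * (1 * x ^+ 1)) =
    (fun x => x ^+ n * expR (- (u * x ^+ 2)) * x ^+ 1).
  by apply/funext => x; rewrite mul1r.
move=> /(_ (integrable_gauss_momentM n 1)); congr is_derive.
  by apply/funext => s; apply: eq_Rintegral => x _; rewrite mul1r.
by apply: eq_Rintegral => x _; rewrite !mul1r expr1 (exprS _ n); ring.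
Qed.

Lemma is_derive_osc_moment_chirp n (v : R) :
  is_derive v (1 : R) (fun v => osc_moment g n v 0) (osc_moment h n.+2 v 0).
Proof.
have := @is_derive_integral_osc _ _ R mu g h _ _ _ v dg g1 h1
  (measurable_exprn 2 1) (measurable_exprn 1 0) (integrable_gauss_moment n u0).
have -> : (fun x : R => x ^+ n * expR (- (u * x ^+ 2)) * (1 * x ^+ 2)) =
    (fun x => x ^+ n * expR (- (u * x ^+ 2)) * x ^+ 2).
  by apply/funext => x; rewrite mul1r.
move=> /(_ (integrable_gauss_momentM n 2)); congr is_derive.
  by apply/funext => s; apply: eq_Rintegral => x _; rewrite mul1r addrC.
by apply: eq_Rintegral => x _; rewrite !mul1r !mul0r addr0 add0r !exprS; ring.
Qed.

(** Integration by parts: the integrand [f] of the left-hand side is the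
    derivative of [x ^+ n * exp(- u x^2) * g (y x + v x^2)]. For [n = 0] the junk
    index [n.-1] is multiplied by [0]. *)
Lemma osc_moment_rec n v y :
  n%:R * osc_moment g n.-1 v y - 2 * u * osc_moment g n.+1 v y +
  (2 * v * osc_moment h n.+1 v y + y * osc_moment h n v y) = 0.
Proof.
pose e x := expR (- (u * x ^+ 2)); pose p x := y * x + v * x ^+ 2.
pose f x := n%:R * (x ^+ n.-1 * e x * g (p x)) -
  2 * u * (x ^+ n.+1 * e x * g (p x)) + (2 * v * (x ^+ n.+1 * e x * h (p x))
  + y * (x ^+ n * e x * h (p x))).
have iZ a (k : R -> R) : mu.-integrable setT (EFin \o k) ->
    mu.-integrable setT (EFin \o (fun x => a * k x)).
  by move=> ig; have := integrableZl measurableT a ig; exact: eq_integrable.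
have i1 := iZ n%:R _ (integrable_osc_moment n.-1 v y cg g1).
have i2 := iZ (2 * u) _ (integrable_osc_moment n.+1 v y cg g1).
have i3 := iZ (2 * v) _ (integrable_osc_moment n.+1 v y ch h1).
have i4 := iZ y _ (integrable_osc_moment n v y ch h1).
have i12 := integrableB measurableT i1 i2.
have i34 := integrableD measurableT i3 i4.
have i1234 := integrableD measurableT i12 i34.
have [c [K [c0 K0 hK]]] := gauss_moment_le n.+1 u0.
have cp : continuous p.
  move=> x; apply: cvgD; first by apply: cvgMr; exact: cvg_id.
  by apply: cvgMr; exact: exprn_continuous.
have ce : continuous e.
  move=> x; apply: continuous_comp; last exact: continuous_expR.
  by apply: cvgN; apply: cvgMr; exact: exprn_continuous.
have ct m (k : R -> R) : continuous k ->
    continuous (fun x : R => x ^+ m * e x * k (p x)).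
  move=> ck x; apply: cvgM; last by apply: continuous_comp; [exact: cp|exact: ck].
  by apply: cvgM; [exact: exprn_continuous|exact: ce].
have : \int[mu]_x f x = 0.
  apply: (@Rintegral_derivative_eq0 R (fun x => x ^+ n * e x * g (p x)) f K).
  - move=> x; apply: cvgD; [apply: cvgB|apply: cvgD]; apply: cvgMr; exact: ct.
  - move=> x.
    have dp : is_derive x (1 : R) p (y + 2 * v * x).
      by rewrite /p; apply: is_derive_eq; rewrite /GRing.scale/=; ring.
    have de : is_derive x (1 : R) e (- (2 * u * x) * e x).
      by rewrite /e; apply: is_derive_eq; rewrite /GRing.scale/=; ring.
    have dgp : is_derive x (1 : R) (g \o p) (h (p x) * (y + 2 * v * x)).
      exact: is_derive1_comp.
    have dxn : is_derive x (1 : R) (fun x => x ^+ n) (n%:R * x ^+ n.-1).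
      have := is_deriveX n (is_derive_id x (1 : R)).
      by rewrite exprfctE /GRing.scale/= mulr1.
    apply: (is_derive_eq (is_deriveM (is_deriveM dxn de) dgp)).
    rewrite /f /GRing.scale/= !fctE.
    by case: (n) => [|m] /=; rewrite ?exprS; ring.
  - move=> x.
    rewrite -normrM (_ : _ * g (p x) * x = x ^+ n.+1 * e x * g (p x)); last first.
      by rewrite (exprS _ n); ring.
    rewrite normrM; apply: le_trans (_ : K * 1 * 1 <= _); last by rewrite !mulr1.
    rewrite ler_pM// (le_trans (hK x))// ler_wpM2l// -[leRHS]expR0 ler_expR oppr_le0.
    exact: mulr_ge0 (ltW c0) (sqr_ge0 _).
  - exact: i1234.
rewrite /f RintegralD ?RintegralB ?RintegralD ?RintegralZl//.
all: exact: integrable_osc_moment.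
Qed.

End bounded_profile.

End oscillatory_moments.

Section gaussian_fourier_real.
Context {R : realType}.
Variables (u : R) (u0 : 0 < u).

Local Notation C := (osc_moment u (@cos R)).
Local Notation S := (osc_moment u (@sin R)).

Let dcos (y : R) : is_derive y (1 : R) cos ((fun y => - sin y) y).
Proof. exact: is_derive_cos. Qed.

Let cos1 (y : R) : `|cos y| <= 1. Proof. exact: cos_max. Qed.
Let sin1 (y : R) : `|sin y| <= 1. Proof. exact: sin_max. Qed.
Let Nsin1 (y : R) : `|- sin y| <= 1. Proof. by rewrite normrN sin_max. Qed.

Let cNsin : continuous (fun y : R => - sin y).
Proof. by move=> y; apply: cvgN; exact: continuous_sin. Qed.

Let oscN n v y : osc_moment u (fun y : R => - sin y) n v y = - S n v y.
Proof.
rewrite /osc_moment -mulN1r -RintegralZl//; last first.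
  exact: integrable_osc_moment (@continuous_sin R) sin1.
by apply: eq_Rintegral => x _; ring.
Qed.

Let dC_freq n v (y : R) : is_derive y (1 : R) (C n v) (- S n.+1 v y).
Proof. by have := is_derive_osc_moment_freq u0 dcos cos1 Nsin1 n v y; rewrite oscN. Qed.

Let dS_freq n v (y : R) : is_derive y (1 : R) (S n v) (C n.+1 v y).
Proof. exact: is_derive_osc_moment_freq. Qed.

Let dC_chirp n (v : R) : is_derive v (1 : R) (fun v => C n v 0) (- S n.+2 v 0).
Proof. by have := is_derive_osc_moment_chirp u0 dcos cos1 Nsin1 n v; rewrite oscN. Qed.

Let dS_chirp n (v : R) : is_derive v (1 : R) (fun v => S n v 0) (C n.+2 v 0).
Proof. exact: is_derive_osc_moment_chirp. Qed.

Let recC n v y : n%:R * C n.-1 v y - 2 * u * C n.+1 v y +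
  (2 * v * - S n.+1 v y + y * - S n v y) = 0.
Proof. by have := osc_moment_rec u0 dcos cos1 cNsin Nsin1 n v y; rewrite !oscN. Qed.

Let recS n v y : n%:R * S n.-1 v y - 2 * u * S n.+1 v y +
  (2 * v * C n.+1 v y + y * C n v y) = 0.
Proof. exact: (osc_moment_rec u0 (@is_derive_sin R) sin1 (@continuous_cos R) cos1). Qed.

(** The recurrence for [n = 0] expresses the first moments linearly in those of
    order [0]; hence the complex number [C - i S] satisfies
    [F' y = - y / (2 w) * F y] for [w = u + i v], whose solution is
    [F 0 * exp(- y^2 / (4 w))]. This is the statement in real terms. *)
Lemma osc_moment_freqE (v y : R) :
  let q := 4 * (u ^+ 2 + v ^+ 2) in
  let e := expR (- (u / q * y ^+ 2)) in
  let c := cos (v / q * y ^+ 2) in let s := sin (v / q * y ^+ 2) in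
  C 0 v y = e * (C 0 v 0 * c + S 0 v 0 * s) /\
  S 0 v y = e * (S 0 v 0 * c - C 0 v 0 * s).
Proof.
move=> q e c s.
have q0 : u ^+ 2 + v ^+ 2 != 0.
  by rewrite gt_eqF// ltr_wpDr ?sqr_ge0// exprn_gt0.
pose E (y : R) := expR (u / q * y ^+ 2).
pose cc (y : R) := cos (v / q * y ^+ 2); pose ss (y : R) := sin (v / q * y ^+ 2).
have dE (z : R) : is_derive z (1 : R) E (2 * (u / q) * z * E z).
  by rewrite /E; apply: is_derive_eq; rewrite /GRing.scale/=; ring.
have dcc (z : R) : is_derive z (1 : R) cc (- (2 * (v / q) * z * ss z)).
  by rewrite /cc; apply: is_derive_eq; rewrite /GRing.scale/= /ss; ring.
have dss (z : R) : is_derive z (1 : R) ss (2 * (v / q) * z * cc z).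
  by rewrite /ss; apply: is_derive_eq; rewrite /GRing.scale/= /cc; ring.
have S1 z : S 1 v z = 2 * (u / q) * z * C 0 v z - 2 * (v / q) * z * S 0 v z.
  have := recC 0 v z; have := recS 0 v z; rewrite !mul0r => h1 h2.
  apply: (mulfI q0); rewrite /q -[LHS]addr0.
  transitivity ((u ^+ 2 + v ^+ 2) * S 1 v z
     + u / 2 * (0 - 2 * u * S 1 v z + (2 * v * C 1 v z + z * C 0 v z))
     + v / 2 * (0 - 2 * u * C 1 v z + (2 * v * - S 1 v z + z * - S 0 v z))).
    by rewrite h1 h2; ring.
  by field.
have C1 z : C 1 v z = - (2 * (u / q) * z * S 0 v z + 2 * (v / q) * z * C 0 v z).
  have := recC 0 v z; have := recS 0 v z; rewrite !mul0r => h1 h2.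
  apply: (mulfI q0); rewrite /q -[LHS]addr0.
  transitivity ((u ^+ 2 + v ^+ 2) * C 1 v z
     - v / 2 * (0 - 2 * u * S 1 v z + (2 * v * C 1 v z + z * C 0 v z))
     + u / 2 * (0 - 2 * u * C 1 v z + (2 * v * - S 1 v z + z * - S 0 v z))).
    by rewrite h1 h2; ring.
  by field.
(* [P] and [Q] are, up to sign, the real and imaginary parts of
   [F z * exp(z^2 / (4 w))], which is constant. *)
pose P z := E z * (C 0 v z * cc z - S 0 v z * ss z).
pose Q z := E z * (S 0 v z * cc z + C 0 v z * ss z).
have dP (z : R) : is_derive z (1 : R) P 0.
  have dC := dC_freq 0 v z; have dS := dS_freq 0 v z.
  have := is_deriveM (dE z) (is_deriveB (is_deriveM dC (dcc z)) (is_deriveM dS (dss z))).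
  move/is_derive_eq; apply; rewrite /GRing.scale/= !fctE C1 S1; ring.
have dQ (z : R) : is_derive z (1 : R) Q 0.
  have dC := dC_freq 0 v z; have dS := dS_freq 0 v z.
  have := is_deriveM (dE z) (is_deriveD (is_deriveM dS (dcc z)) (is_deriveM dC (dss z))).
  move/is_derive_eq; apply; rewrite /GRing.scale/= !fctE C1 S1; ring.
have P0 := is_derive_0_is_cst y 0 dP; have Q0 := is_derive_0_is_cst y 0 dQ.
have [E0 [c0 s0]] : E 0 = 1 /\ cc 0 = 1 /\ ss 0 = 0.
  by rewrite /E /cc /ss expr0n !mulr0 expR0 cos0 sin0.
have Ee : e * E y = 1 by rewrite /e /E -expRD addNr expR0.
have cs : c ^+ 2 + s ^+ 2 = 1 by exact: cos2Dsin2.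
move: P0 Q0; rewrite /P /Q E0 c0 s0 !mul1r !mulr1 !mulr0 subr0 addr0 => <- <-.
rewrite -/c -/s /cc /ss -/c -/s; split.
  transitivity ((e * E y) * (c ^+ 2 + s ^+ 2) * C 0 v y); last by ring.
  by rewrite Ee cs !mul1r.
transitivity ((e * E y) * (c ^+ 2 + s ^+ 2) * S 0 v y); last by ring.
by rewrite Ee cs !mul1r.
Qed.

(** At frequency [0], the recurrence for [n = 1] gives the differential equation
    [F' v = - i / (2 w) * F v] in the chirp rate [v]. It makes [|F|^4 * |w|^2]
    constant, so that the value for [v = 0] -- the real Gaussian integral --
    settles the matter without any choice of a square root of [w]. *)
Lemma osc_moment_modulus (v : R) :
  (C 0 v 0 ^+ 2 + S 0 v 0 ^+ 2) ^+ 2 * (u ^+ 2 + v ^+ 2) = pi ^+ 2.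
Proof.
pose c v := C 0 v 0; pose s v := S 0 v 0.
pose F z := (c z ^+ 2 + s z ^+ 2) ^+ 2 * (u ^+ 2 + z ^+ 2).
have dF (z : R) : is_derive z (1 : R) F 0.
  have q0 : u ^+ 2 + z ^+ 2 != 0.
    by rewrite gt_eqF// ltr_wpDr ?sqr_ge0// exprn_gt0.
  have h1 := recC 1 z 0; have h2 := recS 1 z 0.
  have dc : is_derive z (1 : R) c (- S 2 z 0) := dC_chirp 0 z.
  have ds : is_derive z (1 : R) s (C 2 z 0) := dS_chirp 0 z.
  have dq : is_derive z (1 : R) (fun z => u ^+ 2 + z ^+ 2) (2 * z).
    by apply: is_derive_eq; rewrite /GRing.scale/=; ring.
  have := is_deriveM (is_deriveX 2 (is_deriveD (is_deriveX 2 dc) (is_deriveX 2 ds))) dq.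
  move/is_derive_eq; apply; rewrite /GRing.scale/= !fctE.
  have S2 : S 2 z 0 = (u * s z + z * c z) / (2 * (u ^+ 2 + z ^+ 2)).
    apply: (mulfI q0).
    transitivity ((u ^+ 2 + z ^+ 2) * S 2 z 0
     + u / 2 * (1%:R * S 0 z 0 - 2 * u * S 2 z 0 + (2 * z * C 2 z 0 + 0 * C 1 z 0))
     + z / 2 * (1%:R * C 0 z 0 - 2 * u * C 2 z 0 + (2 * z * - S 2 z 0 + 0 * - S 1 z 0))).
      by rewrite h1 h2; ring.
    by rewrite /c /s; field.
  have C2 : C 2 z 0 = (u * c z - z * s z) / (2 * (u ^+ 2 + z ^+ 2)).
    apply: (mulfI q0).
    transitivity ((u ^+ 2 + z ^+ 2) * C 2 z 0
     - z / 2 * (1%:R * S 0 z 0 - 2 * u * S 2 z 0 + (2 * z * C 2 z 0 + 0 * C 1 z 0))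
     + u / 2 * (1%:R * C 0 z 0 - 2 * u * C 2 z 0 + (2 * z * - S 2 z 0 + 0 * - S 1 z 0))).
      by rewrite h1 h2; ring.
    by rewrite /c /s; field.
  by rewrite S2 C2; field.
have := is_derive_0_is_cst v 0 dF; rewrite /F /c /s => ->.
have -> : S 0 0 0 = 0.
  transitivity (\int[lebesgue_measure]_x (0 * expR (- (u * x ^+ 2)))).
    by apply: eq_Rintegral => x _; rewrite !mul0r addr0 sin0 mulr0.
  by rewrite RintegralZl ?mul0r//; have [] := integral_expR_sqr u0.
have -> : C 0 0 0 = Num.sqrt (pi / u).
  have [h _] := integral_expR_sqr u0.
  rewrite /osc_moment -[RHS](congr1 fine h); apply: eq_Rintegral => x _.
  by rewrite expr0 !mul0r addr0 cos0 mulr1 mul1r.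
rewrite expr0n /= !addr0 sqr_sqrtr ?divr_ge0 ?pi_ge0 ?(ltW u0)//.
by field; rewrite gt_eqF.
Qed.

End gaussian_fourier_real.

(** * Complex exponentials and the Fourier transform of a Gaussian on the line *)

Local Notation Re := complex.Re.
Local Notation Im := complex.Im.
Local Notation normc := ComplexField.Normc.normc.
Local Notation "x %:C" := (real_complex _ x) : ring_scope.

Section complex_parts.
Context {R : rcfType}.
Implicit Types z w : R[i].

Lemma cReM z w : Re (z * w) = Re z * Re w - Im z * Im w.
Proof. by case: z w => [a b] [c d]. Qed.

Lemma cImM z w : Im (z * w) = Re z * Im w + Im z * Re w.
Proof. by case: z w => [a b] [c d]. Qed.

Lemma cReD z w : Re (z + w) = Re z + Re w.
Proof. by case: z w => [a b] [c d]. Qed.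

Lemma cImD z w : Im (z + w) = Im z + Im w.
Proof. by case: z w => [a b] [c d]. Qed.

Lemma cReN z : Re (- z) = - Re z. Proof. by case: z. Qed.

Lemma cImN z : Im (- z) = - Im z. Proof. by case: z. Qed.

Definition cReImE := (cReM, cImM, cReD, cImD, cReN, cImN).

Lemma eq_Re_Im z w : Re z = Re w -> Im z = Im w -> z = w.
Proof. by case: z w => [a b] [c d] /= -> ->. Qed.

Lemma normc_sqr z : normc z ^+ 2 = Re z ^+ 2 + Im z ^+ 2.
Proof. by case: z => a b; rewrite /= sqr_sqrtr// addr_ge0 ?sqr_ge0. Qed.

Lemma normc_ge0 z : 0 <= normc z.
Proof. by case: z => a b; exact: sqrtr_ge0. Qed.

Lemma normcX z n : normc (z ^+ n) = normc z ^+ n.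
Proof.
elim: n => [|n ih]; first by rewrite !expr0 ComplexField.Normc.normc1.
by rewrite !exprS ComplexField.Normc.normcM ih.
Qed.

End complex_parts.

(** Locked, since rewriting with [cReM] and [cImM] would otherwise see through the
    product. *)
HB.lock Definition cexp (R : realType) (z : R[i]) : R[i] :=
  (expR (Re z))%:C * expi (Im z).

Section complex_exponential.
Context {R : realType}.
Implicit Types z w : R[i].

Lemma Re_cexp z : Re (cexp z) = expR (Re z) * cos (Im z).
Proof. by rewrite unlock cReM/= mul0r subr0. Qed.

Lemma Im_cexp z : Im (cexp z) = expR (Re z) * sin (Im z).
Proof. by rewrite unlock cImM/= mul0r addr0. Qed.

Lemma cexpD z w : cexp (z + w) = cexp z * cexp w.
Proof.
by apply: eq_Re_Im; rewrite ?(cReM, cImM) !(Re_cexp, Im_cexp) cReD cImD expRD ?cosD ?sinD; ring.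
Qed.

Lemma cexp0 : cexp 0 = 1 :> R[i].
Proof. by apply: eq_Re_Im; rewrite ?Re_cexp ?Im_cexp/= expR0 ?cos0 ?sin0 ?mulr1 ?mulr0. Qed.

Lemma cexp_sum (I : Type) (s : seq I) (F : I -> R[i]) :
  cexp (\sum_(i <- s) F i) = \prod_(i <- s) cexp (F i).
Proof. exact: (big_morph _ cexpD cexp0). Qed.

Lemma normc_cexp z : normc (cexp z) = expR (Re z).
Proof.
have E0 := expR_ge0 (Re z).
apply/eqP; rewrite -(eqrXn2 (n:=2)) ?normc_ge0// normc_sqr Re_cexp Im_cexp.
by rewrite !exprMn -mulrDr cos2Dsin2 mulr1.
Qed.

Lemma expiE (t : R) : expi t = cexp (Complex 0 t).
Proof. by apply: eq_Re_Im; rewrite ?(Re_cexp, Im_cexp)/= expR0 mul1r. Qed.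

End complex_exponential.

Section complex_integral.
Context d (T : measurableType d) (R : realType).
Variable mu : {measure set T -> \bar R}.
Implicit Types f g : T -> R[i].

Definition Cintegrable f : Prop :=
  mu.-integrable setT (fun x => (Re (f x))%:E) /\
  mu.-integrable setT (fun x => (Im (f x))%:E).

Definition Cintegral f : R[i] :=
  Complex (\int[mu]_x Re (f x)) (\int[mu]_x Im (f x)).

End complex_integral.

Section gaussian_fourier.
Context {R : realType}.
Local Notation mu := (@lebesgue_measure R).
Implicit Types (w : R[i]) (y : R).

Definition gauss_int w : R[i] := Cintegral mu (fun x : R => cexp (- (w * (x ^+ 2)%:C))).

Let gauss_osc w y (x : R) : cexp (- (w * (x ^+ 2)%:C)) * expi (- (y * x)) =
  Complex (x ^+ 0 * expR (- (Re w * x ^+ 2)) * cos (y * x + Im w * x ^+ 2))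
    (- (x ^+ 0 * expR (- (Re w * x ^+ 2)) * sin (y * x + Im w * x ^+ 2))).
Proof.
rewrite expiE -cexpD; apply: eq_Re_Im; rewrite ?(Re_cexp, Im_cexp) !cReImE/=.
  rewrite -[in RHS]cosN; congr (_ * _); last by congr cos; ring.
  by rewrite expr0 mul1r; congr expR; ring.
rewrite [X in _ * sin X](_ : _ = - (y * x + Im w * x ^+ 2)); last by ring.
rewrite sinN mulrN; congr (- (_ * _)).
by rewrite expr0 mul1r; congr expR; ring.
Qed.

Lemma Cintegrable_gauss_fourier w y : 0 < Re w ->
  Cintegrable mu (fun x : R => cexp (- (w * (x ^+ 2)%:C)) * expi (- (y * x))).
Proof.
move=> w0; split.
  have := integrable_osc_moment w0 0 (Im w) y (@continuous_cos R) (@cos_max R).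
  by apply: eq_integrable => // x _; rewrite gauss_osc.
have := integrableN (integrable_osc_moment w0 0 (Im w) y (@continuous_sin R) (@sin_max R)).
by apply: eq_integrable => // x _; rewrite gauss_osc.
Qed.

Let gauss_fourier_osc w y : 0 < Re w ->
  Cintegral mu (fun x : R => cexp (- (w * (x ^+ 2)%:C)) * expi (- (y * x))) =
  Complex (osc_moment (Re w) cos 0 (Im w) y) (- osc_moment (Re w) sin 0 (Im w) y).
Proof.
move=> w0; apply: eq_Re_Im => /=.
  by apply: eq_Rintegral => x _; rewrite gauss_osc.
rewrite -mulN1r -RintegralZl//.
  by apply: eq_Rintegral => x _; rewrite gauss_osc mulN1r.
exact: (integrable_osc_moment w0 0 (Im w) y (@continuous_sin R) (@sin_max R)).
Qed.

Let gauss_int_osc w : 0 < Re w ->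
  gauss_int w =
  Complex (osc_moment (Re w) cos 0 (Im w) 0) (- osc_moment (Re w) sin 0 (Im w) 0).
Proof.
move=> w0; rewrite -gauss_fourier_osc//; congr Cintegral; apply/funext => x.
by rewrite mul0r oppr0 /expi cos0 sin0 mulr1.
Qed.

Lemma gauss_fourier w y : 0 < Re w ->
  Cintegral mu (fun x : R => cexp (- (w * (x ^+ 2)%:C)) * expi (- (y * x))) =
  gauss_int w * cexp (- ((y ^+ 2)%:C / (4 * w))).
Proof.
move=> w0; rewrite gauss_fourier_osc// gauss_int_osc//.
have [-> ->] := osc_moment_freqE w0 (Im w) y.
set q := 4 * _.
have q0 : Re w ^+ 2 + Im w ^+ 2 != 0.
  by rewrite gt_eqF// ltr_wpDr ?sqr_ge0// exprn_gt0.
have -> : - ((y ^+ 2)%:C / (4 * w)) =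
    Complex (- (Re w / q * y ^+ 2)) (Im w / q * y ^+ 2).
  have w_neq0 : w != 0 by apply: contraTneq w0 => ->; rewrite ltxx.
  have w40 : 4 * w != 0 by rewrite mulf_neq0// pnatr_eq0.
  apply: (mulIf w40); rewrite mulNr divfK//.
  rewrite (_ : 4 = (4 : R)%:C); last by rewrite rmorph_nat.
  by apply: eq_Re_Im; rewrite !cReImE /= /q; field.
by apply: eq_Re_Im; rewrite !cReImE !(Re_cexp, Im_cexp)/=; ring.
Qed.

Lemma normc_gauss_int w : 0 < Re w -> normc (gauss_int w) ^+ 2 * normc w = pi.
Proof.
move=> w0; have pi0 := pi_ge0 R.
apply/eqP; rewrite -(eqrXn2 (n:=2))//; last by rewrite mulr_ge0 ?sqr_ge0 ?normc_ge0.
rewrite exprMn !normc_sqr gauss_int_osc//= sqrrN.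
by rewrite osc_moment_modulus.
Qed.

End gaussian_fourier.

(** * Integrals of products of functions of separate variables *)

Section tensor_integral.
Context d1 d2 (T1 : measurableType d1) (T2 : measurableType d2) (R : realType).
Variable m1 : {sigma_finite_measure set T1 -> \bar R}.
Variable m2 : {sigma_finite_measure set T2 -> \bar R}.

Lemma integrable_tensor (f : T1 -> R) (g : T2 -> R) :
  m1.-integrable setT (EFin \o f) -> m2.-integrable setT (EFin \o g) ->
  (m1 \x m2)%E.-integrable setT (EFin \o (fun z => f z.1 * g z.2)).
Proof.
move=> /[dup] fi /integrableP[mf ff] /[dup] gi /integrableP[mg gg].
apply/integrable12ltyP.
  apply/measurable_EFinP; apply: measurable_funM.
    by apply: measurableT_comp measurable_fst; exact/measurable_EFinP.
  by apply: measurableT_comp measurable_snd; exact/measurable_EFinP.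
under eq_integral => x _.
  under eq_integral => y _ do rewrite /= normrM EFinM.
  rewrite ge0_integralZl//=; last first.
    by apply/measurable_EFinP; apply: measurableT_comp => //; exact/measurable_EFinP.
  over.
rewrite ge0_integralZr//=.
- apply: lte_mul_pinfty => //; first exact: integral_ge0.
  by rewrite ge0_fin_numE//; exact: integral_ge0.
- by apply/measurable_EFinP; apply: measurableT_comp => //; exact/measurable_EFinP.
- exact: integral_ge0.
Qed.

Lemma Rintegral_tensor (f : T1 -> R) (g : T2 -> R) :
  m1.-integrable setT (EFin \o f) -> m2.-integrable setT (EFin \o g) ->
  \int[(m1 \x m2)%E]_z (f z.1 * g z.2) = (\int[m1]_x f x) * \int[m2]_y g y.
Proof.
move=> fi gi; rewrite {1}/Rintegral -(integral12_prod_meas1 (integrable_tensor fi gi)).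
rewrite -RintegralZr//; congr fine; apply: eq_integral => x _.
rewrite /fubini_F /= -/(\int[m2]_y (f x * g y)).
under eq_integral do rewrite EFinM.
rewrite integralZl// EFinM fineK//; exact: integrable_fin_num.
Qed.

Lemma Cintegrable_tensor (f : T1 -> R[i]) (g : T2 -> R[i]) :
  Cintegrable m1 f -> Cintegrable m2 g ->
  Cintegrable (m1 \x m2)%E (fun z => f z.1 * g z.2).
Proof.
move=> [fr fi] [gr gi]; split.
  have := integrableB measurableT (integrable_tensor fr gr) (integrable_tensor fi gi).
  by apply: eq_integrable => // z _; rewrite cReM.
have := integrableD measurableT (integrable_tensor fr gi) (integrable_tensor fi gr).
by apply: eq_integrable => // z _; rewrite cImM.
Qed.

Lemma Cintegral_tensor (f : T1 -> R[i]) (g : T2 -> R[i]) :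
  Cintegrable m1 f -> Cintegrable m2 g ->
  Cintegral (m1 \x m2)%E (fun z => f z.1 * g z.2) =
  Cintegral m1 f * Cintegral m2 g.
Proof.
move=> [fr fi] [gr gi]; apply: eq_Re_Im; rewrite ?(cReM, cImM)/=.
  transitivity (\int[(m1 \x m2)%E]_z
      (Re (f z.1) * Re (g z.2) - Im (f z.1) * Im (g z.2))).
    by apply: eq_Rintegral => z _; rewrite cReM.
  rewrite RintegralB//; [|exact: (integrable_tensor fr gr)|exact: (integrable_tensor fi gi)].
  by rewrite (Rintegral_tensor fr gr) (Rintegral_tensor fi gi).
transitivity (\int[(m1 \x m2)%E]_z
    (Re (f z.1) * Im (g z.2) + Im (f z.1) * Re (g z.2))).
  by apply: eq_Rintegral => z _; rewrite cImM.
rewrite RintegralD//; [|exact: (integrable_tensor fr gi)|exact: (integrable_tensor fi gr)].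
by rewrite (Rintegral_tensor fr gi) (Rintegral_tensor fi gr).
Qed.

End tensor_integral.

Section product_integral.
Context {R : realType}.

Lemma uncons_rVK n : cancel (@uncons_rV R n) cons_rV.
Proof.
move=> x; apply/rowP => i; rewrite -!/(coord_rV i _).
have [j ->|->] := unliftP ord0 i; last by rewrite coord_cons_rV0.
by rewrite coord_cons_rVS /uncons_rV /coord_rV mxE.
Qed.

Lemma integral_cons_rV n (g : 'rV[R]_n.+1 -> R) :
  (lebesgue_measure \x lebesgue_rV n)%E.-integrable setT (EFin \o (g \o cons_rV)) ->
  (lebesgue_rV n.+1).-integrable setT (EFin \o g) /\
  \int[lebesgue_rV n.+1]_x g x =
  \int[(lebesgue_measure \x lebesgue_rV n)%E]_z g (cons_rV z).
Proof.
move=> ig; have mg : measurable_fun setT (EFin \o g).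
  have := measurableT_comp (measurable_int _ ig) measurable_uncons_rV.
  by congr measurable_fun; apply/funext => x /=; rewrite uncons_rVK.
split.
  exact: (@integrable_pushforward _ _ (measurableTypeR R * 'rV[R]_n)%type _ R
    cons_rV measurable_cons_rV _ _ _ mg ig measurableT).
congr fine.
exact: (@integral_pushforward _ _ (measurableTypeR R * 'rV[R]_n)%type _ R
  cons_rV measurable_cons_rV _ _ _ mg ig measurableT).
Qed.

Lemma Cintegral_cons_rV n (f : 'rV[R]_n.+1 -> R[i]) :
  Cintegrable (lebesgue_measure \x lebesgue_rV n)%E (f \o cons_rV) ->
  Cintegrable (lebesgue_rV n.+1) f /\
  Cintegral (lebesgue_rV n.+1) f =
  Cintegral (lebesgue_measure \x lebesgue_rV n)%E (f \o cons_rV).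
Proof.
move=> [ir ii].
have [r1 r2] := integral_cons_rV (g := fun x => Re (f x)) ir.
have [i1 i2] := integral_cons_rV (g := fun x => Im (f x)) ii.
by split; [split|apply: eq_Re_Im].
Qed.

(** Integrability and value are proved together: the inductive step splits off
    the first coordinate and applies Fubini to an integrable product. *)
Lemma Cintegral_prod_coord n (h : 'I_n -> R -> R[i]) :
  (forall i, Cintegrable lebesgue_measure (h i)) ->
  Cintegrable (lebesgue_rV n) (fun x => \prod_(i < n) h i (x ord0 i)) /\
  Cintegral (lebesgue_rV n) (fun x => \prod_(i < n) h i (x ord0 i)) =
  \prod_(i < n) Cintegral lebesgue_measure (h i).
Proof.
elim: n h => [|n ih] h hi.
  rewrite big_ord0; under eq_fun do rewrite big_ord0.
  have meas (c : R) : measurable_fun [set: 'rV[R]_0] (fun=> c%:E) by [].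
  have int (c : R) : (\int[lebesgue_rV 0]_(x in [set: 'rV[R]_0]) c%:E = c%:E)%E.
    by rewrite integral_cst//= diracT mule1.
  have fi (c : R) : (lebesgue_rV 0).-integrable [set: 'rV[R]_0] (fun=> c%:E).
    apply/integrableP; split => //.
    by under eq_integral do rewrite abse_EFin; rewrite int ltry.
  split; first by split.
  by apply: eq_Re_Im; rewrite /= /Rintegral int.
pose hS i := h (lift ord0 i).
have [iS eS] := ih hS (fun i => hi _).
have E : (fun x : 'rV[R]_n.+1 => \prod_(i < n.+1) h i (x ord0 i)) \o cons_rV =
    (fun z => h ord0 z.1 * \prod_(i < n) hS i (z.2 ord0 i)).
  apply/funext => z /=; rewrite big_ord_recl -/(coord_rV _ _) coord_cons_rV0.
  congr (_ * _); apply: eq_bigr => i _.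
  by rewrite -[cons_rV z ord0 _]/(coord_rV _ _) coord_cons_rVS.
have it := Cintegrable_tensor (hi ord0) iS.
have [ifE cfE] := @Cintegral_cons_rV n _ (eq_rect_r (Cintegrable _) it E).
split => //; rewrite cfE E big_ord_recl -eS.
exact: (Cintegral_tensor (hi ord0) iS).
Qed.

End product_integral.

Section complex_integral_linear.
Context d (T : measurableType d) (R : realType).
Variable mu : {measure set T -> \bar R}.
Implicit Types f g : T -> R[i].

Lemma CintegrableZ (k : R[i]) f : Cintegrable mu f ->
  Cintegrable mu (fun x => k * f x).
Proof.
move=> [fr fi]; split.
  have := integrableB measurableT (integrableZl measurableT (Re k) fr)
                                  (integrableZl measurableT (Im k) fi).
  by apply: eq_integrable => // x _; rewrite cReM.
have := integrableD measurableT (integrableZl measurableT (Re k) fi)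
                                (integrableZl measurableT (Im k) fr).
by apply: eq_integrable => // x _; rewrite cImM.
Qed.

Lemma CintegrableB f g : Cintegrable mu f -> Cintegrable mu g ->
  Cintegrable mu (fun x => f x - g x).
Proof.
move=> [fr fi] [gr gi]; split.
  have := integrableB measurableT fr gr.
  by apply: eq_integrable => // x _; rewrite cReD cReN.
have := integrableB measurableT fi gi.
by apply: eq_integrable => // x _; rewrite cImD cImN.
Qed.

Lemma CintegralZ (k : R[i]) f : Cintegrable mu f ->
  Cintegral mu (fun x => k * f x) = k * Cintegral mu f.
Proof.
move=> [fr fi].
have Zl a (h : T -> R) : mu.-integrable setT (EFin \o h) ->
    mu.-integrable setT (EFin \o (fun x => a * h x)).
  by move=> ih; have := integrableZl measurableT a ih; exact: eq_integrable.
apply: eq_Re_Im; rewrite ?(cReM, cImM)/=.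
  transitivity (\int[mu]_x (Re k * Re (f x) - Im k * Im (f x))).
    by apply: eq_Rintegral => x _; rewrite cReM.
  by rewrite RintegralB ?RintegralZl//; exact: Zl.
transitivity (\int[mu]_x (Re k * Im (f x) + Im k * Re (f x))).
  by apply: eq_Rintegral => x _; rewrite cImM.
by rewrite RintegralD ?RintegralZl//; exact: Zl.
Qed.

Lemma CintegralB f g : Cintegrable mu f -> Cintegrable mu g ->
  Cintegral mu (fun x => f x - g x) = Cintegral mu f - Cintegral mu g.
Proof.
move=> [fr fi] [gr gi]; apply: eq_Re_Im; rewrite ?(cReD, cReN, cImD, cImN)/=.
  transitivity (\int[mu]_x (Re (f x) - Re (g x))).
    by apply: eq_Rintegral => x _; rewrite cReD cReN.
  by rewrite RintegralB.
transitivity (\int[mu]_x (Im (f x) - Im (g x))).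
  by apply: eq_Rintegral => x _; rewrite cImD cImN.
by rewrite RintegralB.
Qed.

End complex_integral_linear.

(** * Gaussians in several variables *)

Section gaussian_rV.
Context {R : realType} {d : nat}.
Implicit Types (w : R[i]) (x xi : 'rV[R]_d).

Definition sqnorm x : R := \sum_(i < d) x ord0 i ^+ 2.

Definition gaussian w x : R[i] := cexp (- (w * (sqnorm x)%:C)).

Lemma gaussian_prod w x :
  gaussian w x = \prod_(i < d) cexp (- (w * (x ord0 i ^+ 2)%:C)).
Proof.
by rewrite /gaussian /sqnorm rmorph_sum/= mulr_sumr -sumrN cexp_sum.
Qed.

Lemma gaussian_character_prod w x xi :
  gaussian w x * expi (- (2 * pi * dotrV x xi)) =
  \prod_(i < d) (cexp (- (w * (x ord0 i ^+ 2)%:C)) *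
                 expi (- (2 * pi * xi ord0 i * x ord0 i))).
Proof.
rewrite gaussian_prod big_split/=; congr (_ * _).
under eq_bigr do rewrite expiE.
rewrite -cexp_sum expiE; congr cexp.
have -> : \sum_(i < d) Complex 0 (- (2 * pi * xi ord0 i * x ord0 i)) =
    Complex 0 (\sum_(i < d) - (2 * pi * xi ord0 i * x ord0 i)) :> R[i].
  apply/esym/(big_morph (fun t : R => Complex 0 t : R[i])) => // a b.
  by apply: eq_Re_Im; rewrite ?(cReD, cImD)//= addr0.
congr Complex; rewrite sumrN mulr_sumr; congr (- _).
by apply: eq_bigr => i _; ring.
Qed.

Lemma Cintegrable_gaussian_character w xi : 0 < Re w ->
  Cintegrable (lebesgue_rV d) (fun x => gaussian w x * expi (- (2 * pi * dotrV x xi))).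
Proof.
move=> w0; under [X in Cintegrable _ X]eq_fun do rewrite gaussian_character_prod.
have [] := @Cintegral_prod_coord R d (fun i (t : R) =>
  cexp (- (w * (t ^+ 2)%:C)) * expi (- (2 * pi * xi ord0 i * t))) => //.
by move=> i; exact: Cintegrable_gauss_fourier.
Qed.

Lemma fourier_gaussian w xi : 0 < Re w ->
  fourier (gaussian w) xi =
  gauss_int w ^+ d * cexp (- ((pi ^+ 2 * sqnorm xi)%:C / w)).
Proof.
move=> w0; rewrite -[LHS]/(Cintegral (lebesgue_rV d) (fun x => gaussian w x * expi (- (2 * pi * dotrV x xi)))).
under [X in Cintegral _ X]eq_fun do rewrite gaussian_character_prod.
have [_ ->] := @Cintegral_prod_coord R d (fun i (t : R) =>
  cexp (- (w * (t ^+ 2)%:C)) * expi (- (2 * pi * xi ord0 i * t)))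
  (fun i => Cintegrable_gauss_fourier _ w0).
under eq_bigr do rewrite gauss_fourier//.
rewrite big_split/= prodr_const card_ord -cexp_sum; congr (_ * cexp _).
have w_neq0 : w != 0 by apply: contraTneq w0 => ->; rewrite ltxx.
rewrite sumrN -mulr_suml; congr (- _).
rewrite -rmorph_sum/= (_ : \sum_(i < d) _ = 4 * (pi ^+ 2 * sqnorm xi)); last first.
  by rewrite /sqnorm !mulr_sumr; apply: eq_bigr => i _; ring.
rewrite rmorphM/= rmorph_nat; field.
by rewrite w_neq0.
Qed.

Lemma Cintegrable_gaussian w : 0 < Re w -> Cintegrable (lebesgue_rV d) (gaussian w).
Proof.
move=> w0; have := Cintegrable_gaussian_character 0 w0; congr Cintegrable.
apply/funext => x; rewrite (_ : dotrV x 0 = 0) ?mulr0 ?oppr0.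
  by rewrite /expi cos0 sin0 mulr1.
by rewrite /dotrV big1// => i _; rewrite mxE mulr0.
Qed.

Lemma normc_gaussian w x : normc (gaussian w x) = expR (- (Re w * sqnorm x)).
Proof. by rewrite normc_cexp cReN cReM/= mulr0 subr0. Qed.

(** The Fourier transform of a real Gaussian at frequency [0]. *)
Lemma integral_expR_sqnorm (c : R) : 0 < c ->
  (\int[lebesgue_rV d]_x (expR (- (c * sqnorm x)))%:E =
   (Num.sqrt (pi / c) ^+ d)%:E)%E.
Proof.
move=> c0; have c0' : 0 < Re (c%:C) by [].
have gE (y : R) : Re (cexp (- (c%:C * y%:C))) = expR (- (c * y)) /\
    Im (cexp (- (c%:C * y%:C))) = 0.
  by rewrite -rmorphM Re_cexp Im_cexp cReN cImN/= oppr0 cos0 sin0 mulr1 mulr0.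
have [ic _] := Cintegrable_gaussian c0'.
have [e1 _] := integral_expR_sqr c0.
have G : gauss_int c%:C = (Num.sqrt (pi / c))%:C.
  apply: eq_Re_Im => /=.
    rewrite -[RHS](congr1 fine e1); apply: eq_Rintegral => x _.
    by have [-> _] := gE (x ^+ 2).
  transitivity (\int[lebesgue_measure]_(x in [set: R]) (0 : R)).
    by apply: eq_Rintegral => x _; have [_ ->] := gE (x ^+ 2).
  by rewrite /Rintegral integral0.
have := fourier_gaussian 0 c0'.
rewrite (_ : sqnorm 0 = 0); last by rewrite /sqnorm big1// => i _; rewrite mxE expr0n.
rewrite mulr0 mul0r oppr0 cexp0 mulr1 G -rmorphXn/= => /(congr1 (@complex.Re R))/= E.
rewrite -[RHS]/(_ %:E)%E -E /Rintegral fineK.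
  apply: eq_integral => x _; congr _%:E.
  rewrite (_ : dotrV x 0 = 0) ?mulr0 ?oppr0; last first.
    by rewrite /dotrV big1// => i _; rewrite mxE mulr0.
  by rewrite /expi cos0 sin0 mulr1; have [-> _] := gE (sqnorm x).
apply: integrable_fin_num => //.
by have [] := Cintegrable_gaussian_character 0 c0'.
Qed.

End gaussian_rV.

(** * Gaussians times polynomials are Schwartz functions *)

Section directional_derivative.
Context {R : realType} {V : normedModType R}.
Implicit Types (f : V -> R) (x v : V).

(** Reduces directional derivatives to the chain rule in one real variable. *)
Lemma is_derive_line f x v (df : R) :
  is_derive x v f df <->
  is_derive (0 : R) (1 : R) (fun h : R => f (h *: v + x)) df.
Proof.
have E : (fun h : R => h^-1 *: ((f \o shift x) (h *: v) - f x)) =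
    (fun h : R => h^-1 *: (((fun h : R => f (h *: v + x)) \o shift (0 : R)) (h *: 1)
      - (fun h : R => f (h *: v + x)) 0)).
  by apply/funext => h /=; rewrite [_%:A]mulr1 addr0 scale0r add0r.
have D : 'D_v f x = 'D_1 (fun h : R => f (h *: v + x)) 0 by rewrite /derive E.
split=> -[d1 d2].
  by apply: DeriveDef; [exact: (derivable1P _ _ _).1|rewrite -D].
by apply: DeriveDef; [exact: (derivable1P _ _ _).2|rewrite D].
Qed.

Lemma is_derive_comp_line (g : R -> R) f x v (dg df : R) :
  is_derive (f x) (1 : R) g dg -> is_derive x v f df ->
  is_derive x v (fun y => g (f y)) (dg * df).
Proof.
move=> hg /is_derive_line hf; apply/is_derive_line.
by apply: is_derive1_comp; rewrite scale0r add0r.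
Qed.

End directional_derivative.

Section coordinate_derivative.
Context {R : realType} {d : nat}.
Implicit Types (x : 'rV[R]_d) (i j : 'I_d).

Lemma is_derive_coord i j x :
  is_derive x (delta_mx ord0 i) (fun y : 'rV[R]_d => y ord0 j) (i == j)%:R.
Proof.
apply/is_derive_line.
have -> : (fun h : R => (h *: delta_mx ord0 i + x) ord0 j) =
    (fun h : R => h * (i == j)%:R + x ord0 j).
  by apply/funext => h; rewrite !mxE eqxx eq_sym.
by apply: is_derive_eq; rewrite /GRing.scale/=; ring.
Qed.

Lemma is_derive_sqnorm i x :
  is_derive x (delta_mx ord0 i) (@sqnorm R d) (2 * x ord0 i).
Proof.
have dj j : is_derive x (delta_mx ord0 i) (fun y : 'rV[R]_d => y ord0 j ^+ 2)
    ((i == j)%:R * (2 * x ord0 j)).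
  have := is_deriveX 2 (is_derive_coord i j x).
  by move/is_derive_eq; apply; rewrite /GRing.scale/=; ring.
have := is_derive_sum dj.
have -> : \sum_(j < d) (fun y : 'rV[R]_d => y ord0 j ^+ 2) = @sqnorm R d.
  by apply/funext => y; rewrite fct_sumE.
move/is_derive_eq; apply; rewrite (bigD1 i)//= eqxx mul1r big1 ?addr0// => j.
by rewrite eq_sym => /negbTE ->; rewrite mul0r.
Qed.

Lemma continuous_sqnorm : continuous (@sqnorm R d).
Proof.
rewrite /sqnorm; elim: (index_enum _) => [|i s ih].
  by under eq_fun do rewrite big_nil; exact: cst_continuous.
under eq_fun do rewrite big_cons; move=> x.
have ci : continuous (fun y : 'rV[R]_d => y ord0 i ^+ 2).
  move=> y; apply: (@continuous_comp _ _ _ (fun y : 'rV[R]_d => y ord0 i) (fun t : R => t ^+ 2)).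
    exact: coord_continuous.
  exact: exprn_continuous.
exact: (continuousD (ci x) (ih x)).
Qed.

End coordinate_derivative.

Section hermite.
Context {R : realType} {d : nat}.
Implicit Types (f : 'rV[R]_d -> R[i]) (x : 'rV[R]_d).

(** The linear span of the functions polynomial times complex Gaussian, the
    Gaussian being allowed to vary. It is presented by generators so that its
    stability under partial derivatives, and the Gaussian decay of its elements,
    are plain inductions. *)
Inductive hermite : ('rV[R]_d -> R[i]) -> Prop :=
| hermite_gaussian w : 0 < Re w -> hermite (gaussian w)
| hermite_coord i f : hermite f -> hermite (fun x => (x ord0 i)%:C * f x)
| hermite_scale (c : R[i]) f : hermite f -> hermite (fun x => c * f x)
| hermite_add f g : hermite f -> hermite g -> hermite (fun x => f x + g x).

Lemma Re_gaussian w x : Re (gaussian w x) =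
  expR (- (Re w * sqnorm x)) * cos (- (Im w * sqnorm x)).
Proof. by rewrite Re_cexp !cReImE/= mulr0 subr0 mulr0 add0r. Qed.

Lemma Im_gaussian w x : Im (gaussian w x) =
  expR (- (Re w * sqnorm x)) * sin (- (Im w * sqnorm x)).
Proof. by rewrite Im_cexp !cReImE/= mulr0 subr0 mulr0 add0r. Qed.

Lemma coord_le_sqnorm i x : x ord0 i ^+ 2 <= sqnorm x.
Proof.
by rewrite /sqnorm (bigD1 i)//= lerDl sumr_ge0// => j _; exact: sqr_ge0.
Qed.

Lemma sqnorm_ge0 x : 0 <= sqnorm x.
Proof. by apply: sumr_ge0 => j _; exact: sqr_ge0. Qed.

(** A factor [x_i] costs half of the rate of decay. *)
Lemma hermite_decay f : hermite f -> exists c K : R,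
  [/\ 0 < c, 0 <= K & forall x, normc (f x) <= K * expR (- (c * sqnorm x))].
Proof.
elim=> [w w0|i g _ [c [K [c0 K0 h]]]|a g _ [c [K [c0 K0 h]]]
       |g1 g2 _ [c1 [K1 [c10 K10 h1]]] _ [c2 [K2 [c20 K20 h2]]]].
- by exists (Re w), 1; split => // x; rewrite mul1r normc_gaussian.
- have c20 : 0 < c / 2 by lra.
  have [L L0 hL] := norm_le_expR_sqr c20.
  exists (c / 2), (L * K); split => [//||x]; first exact: mulr_ge0.
  rewrite ComplexField.Normc.normcM /= expr0n addr0 sqrtr_sqr.
  have -> : L * K * expR (- (c / 2 * sqnorm x)) =
      L * expR (c / 2 * sqnorm x) * (K * expR (- (c * sqnorm x))).
    rewrite (_ : - (c / 2 * sqnorm x) = c / 2 * sqnorm x + - (c * sqnorm x)); last by field.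
    by rewrite expRD; ring.
  apply: ler_pM => //; first exact: normc_ge0.
  apply: le_trans (hL _) _; rewrite ler_wpM2l// ler_expR ler_pM2l//.
  exact: coord_le_sqnorm.
- exists c, (normc a * K); split => [//||x]; first by rewrite mulr_ge0 ?normc_ge0.
  by rewrite ComplexField.Normc.normcM -mulrA ler_wpM2l ?normc_ge0.
- exists (Num.min c1 c2), (K1 + K2); split => [||x]; first by rewrite lt_min c10.
    exact: addr_ge0.
  apply: le_trans (le_normcD _ _) _; rewrite mulrDl lerD//.
    apply: le_trans (h1 x) _; rewrite ler_wpM2l// ler_expR lerN2.
    by rewrite ler_wpM2r ?sqnorm_ge0// ge_min lexx.
  apply: le_trans (h2 x) _; rewrite ler_wpM2l// ler_expR lerN2.
  by rewrite ler_wpM2r ?sqnorm_ge0// ge_min lexx orbT.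
Qed.

Lemma hermite_continuous f : hermite f ->
  continuous (fun x => Re (f x)) /\ continuous (fun x => Im (f x)).
Proof.
elim=> [w w0|i g _ [cr ci]|a g _ [cr ci]|g1 g2 _ [cr1 ci1] _ [cr2 ci2]].
- have cp (h : R -> R) : continuous h -> continuous (fun x =>
      expR (- (Re w * sqnorm x)) * h (- (Im w * sqnorm x))).
    have cm (a : R) : continuous (fun s : R => - (a * s)).
      by move=> s; apply: cvgN; apply: cvgMr; exact: cvg_id.
    move=> ch x.
    apply: (@continuous_comp _ _ _ (@sqnorm R d)
      (fun s => expR (- (Re w * s)) * h (- (Im w * s)))).
      exact: continuous_sqnorm.
    apply: cvgM; apply: continuous_comp; [exact: cm|exact: continuous_expR|exact: cm|exact: ch].
  split; first by under eq_fun do rewrite Re_gaussian; exact/cp/continuous_cos.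
  by under eq_fun do rewrite Im_gaussian; exact/cp/continuous_sin.
- have ci' x : {for x, continuous (fun y : 'rV[R]_d => y ord0 i)} by exact: coord_continuous.
  split.
    under eq_fun do rewrite cReM/= mul0r subr0.
    by move=> x; exact: (continuousM (ci' x) (cr x)).
  under eq_fun do rewrite cImM/= mul0r addr0.
  by move=> x; exact: (continuousM (ci' x) (ci x)).
- have cZ (b : R) (h : 'rV[R]_d -> R) : continuous h -> continuous (fun x => b * h x).
    move=> ch x; apply: (@continuous_comp _ _ _ h (fun t : R => b * t)); first exact: ch.
    by apply: cvgMr; exact: cvg_id.
  split.
    under eq_fun do rewrite cReM.
    by move=> x; exact: (continuousB (cZ _ _ cr x) (cZ _ _ ci x)).
  under eq_fun do rewrite cImM.
  by move=> x; exact: (continuousD (cZ _ _ ci x) (cZ _ _ cr x)).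
- split.
    under eq_fun do rewrite cReD.
    by move=> x; exact: (continuousD (cr1 x) (cr2 x)).
  under eq_fun do rewrite cImD.
  by move=> x; exact: (continuousD (ci1 x) (ci2 x)).
Qed.

Lemma hermite_derive i f : hermite f -> exists2 g, hermite g & forall x,
  is_derive x (delta_mx ord0 i) (fun y => Re (f y)) (Re (g x)) /\
  is_derive x (delta_mx ord0 i) (fun y => Im (f y)) (Im (g x)).
Proof.
elim=> [w w0|j f0 h0 [g hg dg]|a f0 h0 [g hg dg]|f1 f2 h1 [g1 hg1 dg1] h2 [g2 hg2 dg2]].
- exists (fun x => (- 2 * w) * ((x ord0 i)%:C * gaussian w x)).
    exact/hermite_scale/hermite_coord/hermite_gaussian.
  move=> x; have dq := is_derive_sqnorm i x.
  have dexp : is_derive (sqnorm x) (1 : R) (fun s => expR (- (Re w * s)) * cos (- (Im w * s)))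
      (- Re w * (expR (- (Re w * sqnorm x)) * cos (- (Im w * sqnorm x))) +
       Im w * (expR (- (Re w * sqnorm x)) * sin (- (Im w * sqnorm x)))).
    by apply: is_derive_eq; rewrite /GRing.scale/=; ring.
  have dexp' : is_derive (sqnorm x) (1 : R) (fun s => expR (- (Re w * s)) * sin (- (Im w * s)))
      (- Re w * (expR (- (Re w * sqnorm x)) * sin (- (Im w * sqnorm x))) -
       Im w * (expR (- (Re w * sqnorm x)) * cos (- (Im w * sqnorm x)))).
    by apply: is_derive_eq; rewrite /GRing.scale/=; ring.
  have two : (2 : R[i]) = (2 : R)%:C by rewrite rmorph_nat.
  split.
    under [X in is_derive _ _ X _]eq_fun do rewrite Re_gaussian.
    apply: is_derive_eq (is_derive_comp_line dexp dq) _.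
    by rewrite two !cReImE Re_gaussian Im_gaussian/=; ring.
  under [X in is_derive _ _ X _]eq_fun do rewrite Im_gaussian.
  apply: is_derive_eq (is_derive_comp_line dexp' dq) _.
  by rewrite two !cReImE Re_gaussian Im_gaussian/=; ring.
- exists (fun x => ((i == j)%:R : R)%:C * f0 x + (x ord0 j)%:C * g x).
    by apply: hermite_add; [exact: hermite_scale|exact: hermite_coord].
  move=> x; have [dr di] := dg x; have dc := is_derive_coord i j x; split.
    under [X in is_derive _ _ X _]eq_fun do rewrite cReM/= mul0r subr0.
    apply: is_derive_eq (is_deriveM dc dr) _.
    by rewrite !cReImE /GRing.scale/=; ring.
  under [X in is_derive _ _ X _]eq_fun do rewrite cImM/= mul0r addr0.
  apply: is_derive_eq (is_deriveM dc di) _.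
  by rewrite !cReImE /GRing.scale/=; ring.
- exists (fun x => a * g x); first exact: hermite_scale.
  move=> x; have [dr di] := dg x; split.
    under [X in is_derive _ _ X _]eq_fun do rewrite cReM.
    apply: is_derive_eq (is_deriveB (is_deriveZ (Re a) dr) (is_deriveZ (Im a) di)) _.
    by rewrite !cReImE.
  under [X in is_derive _ _ X _]eq_fun do rewrite cImM.
  apply: is_derive_eq (is_deriveD (is_deriveZ (Re a) di) (is_deriveZ (Im a) dr)) _.
  by rewrite !cReImE.
- exists (fun x => g1 x + g2 x); first exact: hermite_add.
  move=> x; have [dr1 di1] := dg1 x; have [dr2 di2] := dg2 x; split.
    under [X in is_derive _ _ X _]eq_fun do rewrite cReD.
    by apply: is_derive_eq (is_deriveD dr1 dr2) _; rewrite cReD.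
  under [X in is_derive _ _ X _]eq_fun do rewrite cImD.
  by apply: is_derive_eq (is_deriveD di1 di2) _; rewrite cImD.
Qed.

Lemma hermite_cpartials s f : hermite f -> hermite (cpartials s f).
Proof.
move=> hf; elim: s => [//|i s ih] /=.
have [g hg dg] := hermite_derive i ih.
rewrite (_ : cpartial i _ = g)//; apply/funext => x; have [dr di] := dg x.
by apply: eq_Re_Im; rewrite /= derive_val.
Qed.

Lemma hermite_monomial (a : 'I_d -> nat) f : hermite f ->
  hermite (fun x => (\prod_(i < d) x ord0 i ^+ a i)%:C * f x).
Proof.
move=> hf.
have hX n i g : hermite g -> hermite (fun x => (x ord0 i ^+ n)%:C * g x).
  move=> hg; elim: n => [|n ih]; first by under eq_fun do rewrite expr0 mul1r.
  by under eq_fun do rewrite exprS rmorphM -mulrA; exact: hermite_coord.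
elim: (index_enum _) => [|i s ih]; first by under eq_fun do rewrite big_nil mul1r.
by under eq_fun do rewrite big_cons rmorphM -mulrA; exact: hX.
Qed.

Lemma hermite_schwartz f : hermite f -> schwartz f.
Proof.
move=> hf; split=> [s|a s].
  have hs := hermite_cpartials s hf; have [cr ci] := hermite_continuous hs.
  split => //; split => // i x.
  by have [g hg /(_ x)[[? _] [? _]]] := hermite_derive i hs.
have [c [K [c0 K0 hK]]] := hermite_decay (hermite_monomial a (hermite_cpartials s hf)).
exists K => x; apply: le_trans (hK x) _; rewrite ler_piMr// -[leRHS]expR0 ler_expR.
by rewrite oppr_le0 mulr_ge0 ?sqnorm_ge0 ?(ltW c0).
Qed.

End hermite.

(** * Bounds for L^p norms *)

Section norm_bounds.
Context {R : realType} {d : nat}.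
Local Notation mu := (@lebesgue_rV R d).
Implicit Types (f : 'rV[R]_d -> R[i]) (A : set 'rV[R]_d).

Lemma measurable_normc f : Cintegrable mu f ->
  measurable_fun setT (fun x => normc (f x)).
Proof.
move=> [/measurable_int/measurable_EFinP mr /measurable_int/measurable_EFinP mi].
have -> : (fun x => normc (f x)) =
    (fun x => (Re (f x) ^+ 2 + Im (f x) ^+ 2) `^ 2^-1).
  apply/funext => x; rewrite powR12_sqrt ?addr_ge0 ?sqr_ge0//.
  by rewrite -normc_sqr sqrtr_sqr ger0_norm ?normc_ge0.
apply: (measurableT_comp (measurable_powR 2^-1)).
by apply: measurable_funD; exact: measurable_funX.
Qed.

Lemma abse_normc_poweR f (p : R) x :
  ((`|(normc (f x))%:E| `^ p) = (normc (f x) `^ p)%:E)%E.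
Proof. by rewrite gee0_abs ?lee_fin ?normc_ge0// poweR_EFin. Qed.

(** Chebyshev's inequality. The exponent of [v] is [1/r], read as [0] for
    [r = +oo], where the claim holds because a set of positive measure meets the
    complement of every negligible set. *)
Lemma cLnorm_ge f A (r : \bar R) (m v : R) :
  (0 < r)%E -> Cintegrable mu f -> measurable A -> mu A = v%:E -> 0 < v -> 0 <= m ->
  (forall x, A x -> m <= normc (f x)) ->
  ((m * v `^ (if r is r'%:E then r'^-1 else 0))%:E <= cLnorm r f)%E.
Proof.
move=> r0 fi mA muA v0 m0 hA; rewrite /cLnorm unlock.
case: r r0 => [r r0|_|//].
- have r0' : 0 < r by rewrite -lte_fin.
  have mf : measurable_fun setT (fun x => (normc (f x) `^ r)%:E).
    apply/measurable_EFinP; apply: (measurableT_comp (measurable_powR r)).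
    exact: measurable_normc.
  under eq_integral => x _ do rewrite abse_normc_poweR.
  have E : (m * v `^ r^-1)%:E = (((m `^ r * v)%:E) `^ r^-1)%E.
    rewrite poweR_EFin powRM ?powR_ge0 ?(ltW v0)// -powRrM divff ?gt_eqF// powRr1//.
  rewrite E; apply: gt0_ler_poweR.
  + by rewrite invr_ge0 ltW.
  + by rewrite in_itv/= leey lee_fin mulr_ge0 ?powR_ge0 ?ltW.
  + by rewrite in_itv/= leey andbT integral_ge0// => x _; rewrite lee_fin powR_ge0.
  rewrite EFinM -muA -integral_cst//.
  apply: (@le_trans _ _ (\int[mu]_(x in A) (normc (f x) `^ r)%:E)%E).
    apply: ge0_le_integral => //.
    - by move=> x _; rewrite lee_fin powR_ge0.
    - exact: measurable_funTS.
    - move=> x Ax; rewrite lee_fin ge0_ler_powR ?(ltW r0') ?nnegrE ?normc_ge0//.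
      exact: hA.
  by apply: ge0_subset_integral => // x _; rewrite lee_fin powR_ge0.
- have muT : (0 < mu setT)%E.
    apply: lt_le_trans (_ : mu A <= _)%E; first by rewrite muA lte_fin.
    by apply: le_measure => //; rewrite inE.
  rewrite muT powRr0 mulr1 leNgt; apply/negP => lt_m.
  have [N [mN N0 subN]] := ess_sup_inf.ess_sup_ge mu (abse \o (fun x => (normc (f x))%:E)).
  have AN : A `<=` N.
    move=> x Ax; apply: subN => /= hx; have := le_lt_trans hx lt_m.
    by rewrite ger0_norm ?normc_ge0// lte_fin ltNge hA.
  have : (mu A <= mu N)%E by apply: le_measure => //; rewrite inE.
  by rewrite muA N0 lee_fin leNgt v0.
Qed.

Lemma cLnorm_le f (p : R) (B : R) : 0 < p -> 0 <= B ->
  (\int[mu]_x (normc (f x) `^ p)%:E <= B%:E)%E ->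
  (cLnorm p%:E f <= (B `^ p^-1)%:E)%E.
Proof.
move=> p0 B0 hB; rewrite /cLnorm unlock.
under eq_integral => x _ do rewrite abse_normc_poweR.
rewrite -poweR_EFin; apply: gt0_ler_poweR => //.
- by rewrite invr_ge0 ltW.
- by rewrite in_itv/= leey andbT integral_ge0// => x _; rewrite lee_fin powR_ge0.
- by rewrite in_itv/= leey lee_fin B0.
Qed.

Lemma powR_addr_le (p s t : R) : 0 <= p -> 0 <= s -> 0 <= t ->
  (s + t) `^ p <= 2 `^ p * (s `^ p + t `^ p).
Proof.
move=> p0; wlog st : s t / s <= t => [hw s0 t0|s0 t0].
  have [st|/ltW st] := leP s t; first exact: hw.
  by rewrite addrC [X in _ * X]addrC; exact: hw.
apply: le_trans (_ : (2 * t) `^ p <= _).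
  by apply: ge0_ler_powR; rewrite ?nnegrE ?addr_ge0 ?mulr_ge0//; lra.
by rewrite powRM// ler_wpM2l ?powR_ge0// lerDr powR_ge0.
Qed.

Lemma integral_normc_gaussians_le f (p a b k : R) :
  0 < p -> 0 < a -> 0 < b -> 0 <= k -> Cintegrable mu f ->
  (forall x, normc (f x) <= expR (- (a * sqnorm x)) + k * expR (- (b * sqnorm x))) ->
  (\int[mu]_x (normc (f x) `^ p)%:E <=
   (2 `^ p * (Num.sqrt (pi / (p * a)) ^+ d +
              k `^ p * Num.sqrt (pi / (p * b)) ^+ d))%:E)%E.
Proof.
move=> p0 a0 b0 k0 fi hf.
have pa0 : 0 < p * a by exact: mulr_gt0.
have pb0 : 0 < p * b by exact: mulr_gt0.
have mexp (c : R) : 0 < c -> measurable_fun setT (fun x : 'rV[R]_d => (expR (- (c * sqnorm x)))%:E).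
  move=> c0; have c0' : 0 < Re (c%:C) by [].
  have /measurable_normc/measurable_EFinP := @Cintegrable_gaussian R d _ c0'.
  by congr measurable_fun; apply/funext => x /=; rewrite normc_gaussian.
have powE (c : R) x : expR (- (c * sqnorm x)) `^ p = expR (- (p * c * sqnorm x)) :> R.
  by rewrite -expRM; congr expR; ring.
have bnd x : normc (f x) `^ p <= 2 `^ p * expR (- (p * a * sqnorm x)) +
    2 `^ p * k `^ p * expR (- (p * b * sqnorm x)).
  apply: le_trans (_ : (expR (- (a * sqnorm x)) + k * expR (- (b * sqnorm x))) `^ p <= _).
    by rewrite ge0_ler_powR ?(ltW p0) ?nnegrE ?normc_ge0 ?addr_ge0 ?mulr_ge0 ?expR_ge0.
  apply: le_trans (powR_addr_le _ _ _) _; rewrite ?(ltW p0) ?mulr_ge0 ?expR_ge0//.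
  by rewrite powRM ?expR_ge0// !powE mulrDr mulrA.
apply: (@le_trans _ _ (\int[mu]_x ((2 `^ p)%:E * (expR (- (p * a * sqnorm x)))%:E +
    (2 `^ p * k `^ p)%:E * (expR (- (p * b * sqnorm x)))%:E))%E).
  apply: ge0_le_integral => //.
  - by move=> x _; rewrite lee_fin powR_ge0.
  - apply/measurable_EFinP; apply: (measurableT_comp (measurable_powR p)).
    exact: measurable_normc.
  - by apply: emeasurable_funD; apply: measurable_funeM; exact: mexp.
  - by move=> x _; rewrite -!EFinM -EFinD lee_fin.
rewrite ge0_integralD//.
- rewrite !ge0_integralZl ?lee_fin ?mulr_ge0 ?powR_ge0//; try exact: mexp.
  by rewrite !integral_expR_sqnorm// -!EFinM -EFinD lee_fin mulrDr mulrA.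
- by apply: measurable_funeM; exact: mexp.
- by move=> x _; rewrite -EFinM lee_fin mulr_ge0 ?mulr_ge0 ?powR_ge0 ?expR_ge0.
- by apply: measurable_funeM; exact: mexp.
Qed.

Lemma lebesgue_cube (e : R) : 0 < e ->
  let A := [set x : 'rV[R]_d | forall i, `|x ord0 i| <= e] in
  measurable A /\ mu A = ((2 * e) ^+ d)%:E.
Proof.
move=> e0 A.
have AE : A = [set x : 'rV[R]_d | forall i, `[- e, e]%classic (x ord0 i)].
  by apply/seteqP; split => x xA i; have := xA i; rewrite /= in_itv/= ler_norml.
rewrite AE; split.
  rewrite (_ : [set x | _] = \bigcap_(i in [set: 'I_d]) (coord_rV i @^-1` `[- e, e]%classic)).
    apply: fin_bigcap_measurable => // i _.
    by rewrite -[X in measurable X]setTI; exact: measurable_coord_rV.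
  by apply/seteqP; split => [x xA i _|x xA i]; [exact: xA|exact: (xA i)].
rewrite (lebesgue_rV_box (A := fun=> `[- e, e]%classic)); last first.
  by move=> i; exact: measurable_itv.
under eq_bigr => i _.
  rewrite lebesgue_measure_itv/= lte_fin ifT; last by lra.
  rewrite -EFinB (_ : e - - e = 2 * e); last by ring.
  over.
by rewrite prodEFin prodr_const card_ord.
Qed.

End norm_bounds.

(** * The difference of a narrow Gaussian and its dispersed copy *)

Section concentrated_difference.
Context {R : realType} {d : nat}.
Implicit Types (a b eps : R) (x xi : 'rV[R]_d).

Lemma cexp_2pi_nat (n : nat) : cexp (Complex 0 (- (2 * pi * n%:R))) = 1 :> R[i].
Proof.
elim: n => [|n ih]; first by rewrite mulr0 oppr0 cexp0.
rewrite (_ : Complex _ _ = Complex 0 (- (2 * pi * n%:R)) + Complex 0 (- (pi *+ 2))); last first.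
  by apply: eq_Re_Im; rewrite ?(cReD, cImD)/= ?addr0// -natr1 -mulr_natl; ring.
rewrite cexpD ih mul1r; apply: eq_Re_Im; rewrite ?(Re_cexp, Im_cexp)/= expR0 mul1r.
  by rewrite cosN cos2pi.
by rewrite sinN sin2pi oppr0.
Qed.

(** The exponent [w] for which [exp(- w |x|^2)] has, up to a constant factor, the
    Fourier transform [exp(- pi^2 (a + i b) |xi|^2)]. *)
Definition dispersed a b : R[i] := (Complex a b)^-1.

Lemma Re_dispersed a b : Re (dispersed a b) = a / (a ^+ 2 + b ^+ 2).
Proof. by []. Qed.

(** The ratio of the two Fourier transforms at frequency [0]. *)
Definition gauss_ratio a b : R[i] :=
  (gauss_int (dispersed a 0) / gauss_int (dispersed a b)) ^+ d.

Definition concentrated a b x : R[i] :=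
  gaussian (dispersed a 0) x - gauss_ratio a b * gaussian (dispersed a b) x.

Section positive_width.
Variables (a b : R).
Hypothesis a0 : 0 < a.

Let Re_dispersed_gt0 c : 0 < Re (dispersed a c).
Proof. by rewrite Re_dispersed divr_gt0// ltr_wpDr ?sqr_ge0// exprn_gt0. Qed.

Let gauss_int_neq0 c : gauss_int (dispersed a c) != 0.
Proof.
apply/eqP => h; have := normc_gauss_int (Re_dispersed_gt0 c).
rewrite h ComplexField.Normc.normc0 expr0n mul0r => /eqP.
by rewrite eq_sym gt_eqF// pi_gt0.
Qed.

Lemma schwartz_concentrated : schwartz (concentrated a b).
Proof.
have -> : concentrated a b = (fun x => gaussian (dispersed a 0) x +
    (- gauss_ratio a b) * gaussian (dispersed a b) x).
  by apply/funext => x; rewrite /concentrated mulNr.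
apply: hermite_schwartz; apply: hermite_add; first exact: hermite_gaussian.
exact/hermite_scale/hermite_gaussian.
Qed.

Lemma Cintegrable_concentrated : Cintegrable (lebesgue_rV d) (concentrated a b).
Proof.
apply: CintegrableB; first exact: Cintegrable_gaussian.
exact/CintegrableZ/Cintegrable_gaussian.
Qed.

(** The transforms of the two Gaussians differ by the factor
    [exp(- i pi^2 b |xi|^2)], that is [exp(- 2 i pi |xi|^2)] for [b = 2 / pi]. *)
Lemma fourier_concentrated xi (n : nat) :
  b = 2 / pi -> sqnorm xi = n%:R -> fourier (concentrated a b) xi = 0.
Proof.
move=> bE xiE; have pi_neq0 : pi != 0 :> R by rewrite gt_eqF ?pi_gt0.
pose E w (x : 'rV[R]_d) := gaussian w x * expi (- (2 * pi * dotrV x xi)).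
have iE c : Cintegrable (lebesgue_rV d) (E (dispersed a c)).
  exact: Cintegrable_gaussian_character.
transitivity (fourier (gaussian (dispersed a 0)) xi -
    gauss_ratio a b * fourier (gaussian (dispersed a b)) xi).
  transitivity (Cintegral (lebesgue_rV d)
      (fun x => E (dispersed a 0) x - gauss_ratio a b * E (dispersed a b) x)).
    congr Cintegral; apply/funext => x.
    by rewrite /concentrated /E mulrBl mulrA.
  rewrite CintegralB ?CintegralZ//; exact: CintegrableZ.
rewrite !fourier_gaussian//.
have -> : cexp (- ((pi ^+ 2 * sqnorm xi)%:C / dispersed a b)) =
    cexp (- ((pi ^+ 2 * sqnorm xi)%:C / dispersed a 0)).
  rewrite /dispersed !invrK xiE.
  rewrite -[RHS]mulr1 -(cexp_2pi_nat n) -cexpD; congr cexp.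
  by apply: eq_Re_Im; rewrite !cReImE/= bE; move: pi_neq0; move: (pi : R) => q q0; field.
rewrite /gauss_ratio mulrA -exprMn divfK ?gauss_int_neq0//; exact: subrr.
Qed.

Lemma X_space_concentrated : b = 2 / pi -> X_space (concentrated a b).
Proof.
move=> bE; split; first exact: Cintegrable_concentrated.
move=> xi m /(congr1 (fun t => t ^+ 2)).
have m0 : 0 <= \sum_(i < d) ((m i)%:~R : R) ^+ 2.
  by apply: sumr_ge0 => i _; exact: sqr_ge0.
rewrite /eucl_norm !sqr_sqrtr//; last exact: sqnorm_ge0.
move=> xiE; apply: (@fourier_concentrated _ (\sum_(i < d) `|m i| ^ 2)%N) => //.
rewrite /sqnorm xiE natr_sum; apply: eq_bigr => i _.
by rewrite natrX natr_absz intr_norm real_normK ?num_real.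
Qed.

(** Since [|G w|^2 = pi / |w|], the square of the ratio of the two constants is
    [a / |a + i b|] in modulus. *)
Lemma normc_gauss_ratio_le : 0 < b -> normc (gauss_ratio a b) <= Num.sqrt (a / b) ^+ d.
Proof.
move=> b0; rewrite normcX lerXn2r ?nnegrE ?sqrtr_ge0 ?normc_ge0//.
rewrite ComplexField.Normc.normcM ComplexField.Normc.normcV.
rewrite -(@ler_pXn2r _ 2) ?nnegrE ?divr_ge0 ?normc_ge0 ?sqrtr_ge0//.
rewrite sqr_sqrtr ?divr_ge0 ?(ltW a0) ?(ltW b0)// expr_div_n.
have G c : normc (gauss_int (dispersed a c)) ^+ 2 = pi * normc (Complex a c).
  have := normc_gauss_int (Re_dispersed_gt0 c).
  rewrite {2}/dispersed ComplexField.Normc.normcV => /(canRL (mulfVK _)) ->//.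
  apply: contraTneq (Re_dispersed_gt0 c) => /ComplexField.Normc.eq0_normc h.
  by rewrite /dispersed h invr0 ltxx.
have N0 : normc (Complex a 0) = a by rewrite /= expr0n addr0 sqrtr_sqr gtr0_norm.
have Nb : b <= normc (Complex a b).
  rewrite /= -[leLHS]gtr0_norm// -sqrtr_sqr ler_wsqrtr// lerDr; exact: sqr_ge0.
rewrite !G N0 -mulf_div divff ?gt_eqF ?pi_gt0// mul1r.
by rewrite ler_pM2l// lef_pV2// posrE (lt_le_trans b0).
Qed.

End positive_width.

End concentrated_difference.

(** * Estimates of the two norms *)

Section norm_ratio.
Context {R : realType} {d : nat}.
Implicit Types (b eps p : R) (x : 'rV[R]_d).

Lemma sqr_gauss_widthE b eps : 0 < eps ->
  Re (dispersed (eps ^+ 2) b) = eps ^+ 2 / (eps ^+ 4 + b ^+ 2).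
Proof. by move=> e0; rewrite Re_dispersed -exprM. Qed.

(** On the cube the narrow Gaussian is at least [exp(- d)], and [eps] is small
    enough for the dispersed one to be at most half of that. *)
Lemma concentrated_ge b eps : (0 < d)%N -> 0 < b -> 0 < eps ->
  eps <= Num.sqrt b * (expR (-1) / 2) ->
  forall x, (forall i, `|x ord0 i| <= eps) ->
  expR (- d%:R) / 2 <= normc (concentrated (eps ^+ 2) b x).
Proof.
move=> d0 b0 e0 eb x xe; have e20 : 0 < eps ^+ 2 by rewrite exprn_gt0.
have sb0 : 0 < Num.sqrt b by rewrite sqrtr_gt0.
have g0 : expR (- d%:R) <= normc (gaussian (dispersed (eps ^+ 2) 0) x).
  rewrite normc_gaussian Re_dispersed ler_expR lerN2.
  rewrite (_ : _ / _ = (eps ^+ 2)^-1); last by field; rewrite gt_eqF.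
  rewrite mulrC ler_pdivrMr// /sqnorm; apply: le_trans (_ : \sum_(i < d) eps ^+ 2 <= _).
    apply: ler_sum => i _; rewrite -real_normK ?num_real// lerXn2r ?nnegrE ?(ltW e0)//.
  by rewrite sumr_const card_ord mulr_natl.
have k0 : normc (gauss_ratio (d := d) (eps ^+ 2) b) <= expR (- d%:R) / 2.
  apply: le_trans (normc_gauss_ratio_le (d := d) e20 b0) _.
  rewrite sqrtrM ?sqr_ge0// sqrtr_sqr gtr0_norm// sqrtrV ?(ltW b0)//.
  apply: le_trans (_ : (expR (-1) / 2) ^+ d <= _).
    rewrite lerXn2r ?nnegrE ?divr_ge0 ?expR_ge0 ?(ltW e0) ?(ltW sb0)//.
    by rewrite ler_pdivrMr// mulrC.
  rewrite exprMn -expRM_natl mulrN1 ler_wpM2l ?expR_ge0//.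
  by rewrite exprVn lef_pV2 ?posrE ?exprn_gt0// -[leLHS]expr1 ler_eXn2l// ltr1n.
have g1 : normc (gauss_ratio (d := d) (eps ^+ 2) b * gaussian (dispersed (eps ^+ 2) b) x) <=
    expR (- d%:R) / 2.
  rewrite ComplexField.Normc.normcM; apply: le_trans k0.
  rewrite ler_piMr ?normc_ge0// normc_gaussian -[leRHS]expR0 ler_expR oppr_le0.
  by rewrite mulr_ge0 ?sqnorm_ge0// Re_dispersed divr_ge0 ?addr_ge0 ?sqr_ge0.
have := le_normcD (concentrated (eps ^+ 2) b x)
  (gauss_ratio (d := d) (eps ^+ 2) b * gaussian (dispersed (eps ^+ 2) b) x).
rewrite {1}/concentrated subrK => h.
by have := le_trans g0 h; lra.
Qed.

(** The first summand is due to the narrow Gaussian, the second to the dispersed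
    one. *)
Definition cLnorm_const b p : R := 2 `^ p *
  (Num.sqrt (pi / p) ^+ d + (Num.sqrt b)^-1 `^ (d%:R * p) * Num.sqrt (2 * pi / p) ^+ d).

Lemma cLnorm_const_gt0 b p : 0 < p -> 0 < cLnorm_const b p.
Proof.
move=> p0; rewrite mulr_gt0 ?powR_gt0// ltr_wpDr//.
by rewrite exprn_gt0// sqrtr_gt0 divr_gt0 ?pi_gt0.
Qed.

(** The two Gaussians contribute [eps ^ d] and [eps ^ (d p) * eps ^ (- d)] to the
    integral of the [p]-th power; for [eps <= 1] and [p <= 2] the latter,
    [eps ^ (d (p - 1))], dominates. *)
Lemma cLnorm_concentrated_le b eps p : 1 < p -> p <= 2 -> 0 < b -> b <= 1 ->
  0 < eps -> eps <= 1 ->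
  (cLnorm p%:E (concentrated (d := d) (eps ^+ 2) b) <=
   (cLnorm_const b p `^ p^-1 * eps `^ (d%:R * ((p - 1) / p)))%:E)%E.
Proof.
move=> p1 p2 b0 b1 e0 e1; have p0 : 0 < p by lra.
have e20 : 0 < eps ^+ 2 by rewrite exprn_gt0.
have q0 : 0 < eps ^+ 4 + b ^+ 2 by rewrite addr_gt0 ?exprn_gt0.
have sb0 : 0 < Num.sqrt b by rewrite sqrtr_gt0.
have C0 := cLnorm_const_gt0 b p0.
have -> : cLnorm_const b p `^ p^-1 * eps `^ (d%:R * ((p - 1) / p)) =
    (cLnorm_const b p * eps `^ (d%:R * (p - 1))) `^ p^-1.
  by rewrite powRM ?powR_ge0 ?(ltW C0)// -powRrM mulrA.
have alg (c : R) : c / (p * (eps ^+ 2 / (eps ^+ 4 + b ^+ 2))) =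
    (eps ^+ 4 + b ^+ 2) * (c / p * (eps^-1) ^+ 2).
  by field; rewrite !gt_eqF.
have alg0 (c : R) : c / (p * (eps ^+ 2)^-1) = c / p * eps ^+ 2.
  by field; rewrite !gt_eqF.
have ic := Cintegrable_concentrated (d := d) b e20.
apply: cLnorm_le => //; first by rewrite mulr_ge0 ?powR_ge0 ?ltW.
set k := normc (gauss_ratio (d := d) (eps ^+ 2) b).
have k0 : 0 <= k by exact: normc_ge0.
apply: le_trans (@integral_normc_gaussians_le R d _ p (eps ^+ 2)^-1
  (eps ^+ 2 / (eps ^+ 4 + b ^+ 2)) k p0 _ _ k0 ic _) _.
- by rewrite invr_gt0.
- by rewrite divr_gt0.
- move=> x; apply: le_trans (le_normcD _ _) _.
  rewrite normcN ComplexField.Normc.normcM !normc_gaussian sqr_gauss_widthE//.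
  rewrite sqr_gauss_widthE// expr0n addr0 -/k.
  by rewrite (_ : _ / _ = (eps ^+ 2)^-1)//; field; rewrite gt_eqF.
rewrite lee_fin /cLnorm_const -[leRHS]mulrA ler_wpM2l ?powR_ge0//.
rewrite [leRHS]mulrDl; apply: lerD.
  rewrite alg0 sqrtrM ?divr_ge0 ?pi_ge0 ?(ltW p0)// sqrtr_sqr gtr0_norm// exprMn.
  rewrite ler_wpM2l ?exprn_ge0 ?sqrtr_ge0// -powR_mulrn ?(ltW e0)//.
  rewrite ger_powR ?e0// ler_piMr//; lra.
have kle : k `^ p <= (Num.sqrt b)^-1 `^ (d%:R * p) * eps `^ (d%:R * p).
  rewrite -powRM ?invr_ge0 ?(ltW sb0) ?(ltW e0)// powRrM ge0_ler_powR ?nnegrE ?(ltW p0)//.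
    exact: powR_ge0.
  rewrite powR_mulrn ?mulr_ge0 ?invr_ge0 ?(ltW sb0) ?(ltW e0)//.
  apply: le_trans (normc_gauss_ratio_le (d := d) e20 b0) _.
  by rewrite sqrtrM ?sqr_ge0// sqrtr_sqr gtr0_norm// sqrtrV ?(ltW b0)// mulrC.
have sle : Num.sqrt (pi / (p * (eps ^+ 2 / (eps ^+ 4 + b ^+ 2)))) ^+ d <=
    Num.sqrt (2 * pi / p) ^+ d * eps ^- d.
  rewrite -exprVn -exprMn lerXn2r ?nnegrE ?mulr_ge0 ?sqrtr_ge0 ?invr_ge0 ?(ltW e0)//.
  have pip0 : 0 <= pi / p :> R by rewrite divr_ge0 ?pi_ge0 ?(ltW p0).
  have -> : Num.sqrt (2 * pi / p) * eps^-1 = Num.sqrt (2 * (pi / p * (eps^-1) ^+ 2)).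
    have -> : 2 * (pi / p * (eps^-1) ^+ 2) = (2 * pi / p) * (eps^-1) ^+ 2.
      by rewrite !mulrA.
    rewrite [RHS]sqrtrM ?sqrtr_sqr ?gtr0_norm ?invr_gt0//.
    by rewrite divr_ge0 ?mulr_ge0 ?pi_ge0 ?(ltW p0).
  rewrite ler_wsqrtr// alg (ler_wpM2r (mulr_ge0 pip0 (sqr_ge0 _)))//.
  have e4 : eps ^+ 4 <= 1 by rewrite exprn_ile1 ?(ltW e0).
  have b2 : b ^+ 2 <= 1 by rewrite exprn_ile1 ?(ltW b0).
  lra.
apply: le_trans (ler_pM _ _ kle sle) _; rewrite ?powR_ge0 ?exprn_ge0 ?sqrtr_ge0//.
have -> : eps `^ (d%:R * (p - 1)) = eps `^ (d%:R * p) * eps ^- d.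
  rewrite mulrBr mulr1 powRB ?(gt_eqF e0) ?implybT// powR_mulrn ?(ltW e0)//.
by rewrite le_eqVlt; apply/orP; left; apply/eqP; ring.
Qed.

End norm_ratio.

Lemma cvg_scaled_powR_pinfty (R : realType) (c t : R) : 0 < c -> 0 < t ->
  (c * n.+1%:R `^ t)%:E @[n --> \oo] --> +oo%E.
Proof.
move=> c0 t0; apply/cvgeyPge => A.
near=> n; rewrite lee_fin -ler_pdivrMl//.
have Ac : 0 <= `|c^-1 * A| `^ t^-1 by exact: powR_ge0.
apply: le_trans (ler_norm _) _.
rewrite -[leLHS](_ : (`|c^-1 * A| `^ t^-1) `^ t = _); last first.
  by rewrite -powRrM mulVf ?gt_eqF// powRr1.
apply: ge0_ler_powR; rewrite ?nnegrE ?(ltW t0)//.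
apply: le_trans (ltW (truncnS_gt _)) _; rewrite ler_nat ltnS.
by near: n; exact: nbhs_infty_ge.
Unshelve. all: by end_near. Qed.

Theorem lemma4 (R : realType) (d : nat) (p : R) (r : \bar R) :
  (1 <= d)%N -> 1 < p -> p <= 2 -> (hoelder_conjugate p%:E < r)%E ->
  exists f : nat -> 'rV[R]_d -> R[i],
    (forall n, [/\ schwartz (f n), X_space (f n) & exists x, f n x != 0]) /\
    (cLnorm r (f n) / cLnorm p%:E (f n))%E @[n --> \oo] --> +oo%E.
Proof.
move=> d0 p1 p2 qr; have p0 : 0 < p by lra.
pose b : R := 2 / pi.
have b0 : 0 < b by rewrite divr_gt0 ?pi_gt0.
have b1 : b <= 1 by rewrite ler_pdivrMr ?pi_gt0// mul1r pi_ge2.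
(* The largest width allowed by [concentrated_ge]. *)
pose delta : R := Num.sqrt b * (expR (-1) / 2).
have delta0 : 0 < delta by rewrite mulr_gt0 ?sqrtr_gt0// divr_gt0 ?expR_gt0.
have delta1 : delta <= 1.
  have sb1 : Num.sqrt b <= 1 by rewrite -sqrtr1 ler_wsqrtr.
  have e1 : expR (-1) / 2 <= 1 :> R.
    have : expR (-1) <= 1 :> R by rewrite -[leRHS]expR0 ler_expR lerN10.
    by have := expR_gt0 (-1 : R); lra.
  by rewrite mulr_ile1 ?sqrtr_ge0 ?divr_ge0 ?expR_ge0.
pose eps (n : nat) : R := delta / n.+1%:R.
have eps0 n : 0 < eps n by rewrite divr_gt0 ?ltr0n.
have epsd n : eps n <= delta by rewrite ler_pdivrMr ?ltr0n// ler_peMr ?(ltW delta0)// ler1n.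
have eps1 n : eps n <= 1 by exact: le_trans (epsd n) delta1.
have epsV n : n.+1%:R <= (eps n)^-1.
  by rewrite /eps invf_div ler_pdivlMr// ler_piMr.
have eps2 n : 0 < eps n ^+ 2 by rewrite exprn_gt0.
have r0 : (0 < r)%E.
  apply: le_lt_trans qr; apply: le_trans (hoelder_conj_ge1 _); rewrite ?lee_fin//.
  exact: ltW.
pose s : R := if r is r'%:E then r'^-1 else 0.
(* [(p - 1) / p] is the inverse of the exponent conjugate to [p]. *)
have s_lt : s < (p - 1) / p.
  have p10 : 0 < p - 1 by lra.
  have qE : hoelder_conjugate p%:E = (p / (p - 1))%:E.
    rewrite /hoelder_conjugate /= eqe gt_eqF// -EFinB inver gt_eqF//.
  move: qr r0; rewrite qE /s; case: (r) => [r'|_ _|//].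
    rewrite !lte_fin => qr' r'0; rewrite -[ltRHS]invrK invf_div.
    by rewrite ltf_pV2 ?posrE ?divr_gt0.
  by rewrite divr_gt0.
pose f n : 'rV[R]_d -> R[i] := concentrated (eps n ^+ 2) b.
pose m : R := expR (- d%:R) / 2.
have m0 : 0 < m by rewrite divr_gt0 ?expR_gt0.
have f_ge n (x : 'rV[R]_d) : (forall i, `|x ord0 i| <= eps n) -> m <= normc (f n x).
  exact: (concentrated_ge d0 b0 (eps0 n) (epsd n)).
exists f; split=> [n|].
  split; [exact: schwartz_concentrated|exact: X_space_concentrated|exists 0].
  have : m <= normc (f n 0) by apply: f_ge => i; rewrite mxE normr0 ltW.
  by apply: contraTneq => ->; rewrite ComplexField.Normc.normc0 -ltNge.
pose K := @cLnorm_const R d b p `^ p^-1.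
have K0 : 0 < K by rewrite powR_gt0// cLnorm_const_gt0.
pose t := d%:R * ((p - 1) / p - s).
have t0 : 0 < t by rewrite mulr_gt0 ?ltr0n ?subr_gt0.
have mK0 : 0 < m / K := divr_gt0 m0 K0.
apply: (gee_cvgy _ (cvg_scaled_powR_pinfty mK0 t0)).
apply: nearW => n.
have [mA muA] := @lebesgue_cube R d _ (eps0 n).
have v0 : 0 < (2 * eps n) ^+ d by rewrite exprn_gt0// mulr_gt0.
have lower : ((m * eps n `^ (d%:R * s))%:E <= cLnorm r (f n))%E.
  apply: le_trans (cLnorm_ge r0 (Cintegrable_concentrated b (eps2 n)) mA muA v0
    (ltW m0) (f_ge n)).
  rewrite lee_fin -/s ler_wpM2l ?(ltW m0)// powRrM powR_mulrn ?(ltW (eps0 n))//.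
  have s0 : 0 <= s by rewrite /s; case: (r) r0 => // r'; rewrite lte_fin invr_ge0 => /ltW.
  rewrite ge0_ler_powR ?nnegrE ?exprn_ge0 ?mulr_ge0 ?(ltW (eps0 n))//.
  rewrite lerXn2r ?nnegrE ?mulr_ge0 ?(ltW (eps0 n))//.
  by have := eps0 n; lra.
have upper := cLnorm_concentrated_le (d := d) p1 p2 b0 b1 (eps0 n) (eps1 n).
rewrite -/(f n) -/K in upper.
have c0 : (0 <= cLnorm p%:E (f n))%E by exact: Lnorm_ge0.
have : cLnorm p%:E (f n) \is a fin_num by rewrite ge0_fin_numE// (le_lt_trans upper) ?ltry.
move: c0 upper; case: (cLnorm p%:E (f n)) => [c|//|//]; rewrite !lee_fin => c0 upper _.
have L0 : 0 < m * eps n `^ (d%:R * s) by rewrite mulr_gt0 ?powR_gt0.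
(* Division by [0] gives [+oo], so that the bound holds without knowing that the
   norm is positive. *)
have [->|c_neq0] := eqVneq c 0.
  rewrite inve0 gt0_muley ?leey//; apply: lt_le_trans lower; by rewrite lte_fin.
have {c_neq0}c0 : 0 < c by rewrite lt_neqAle eq_sym c_neq0.
rewrite inver gt_eqF// lee_pdivlMr//; apply: le_trans lower.
rewrite -EFinM lee_fin.
apply: (@le_trans _ _ (m / K * (eps n)^-1 `^ t * (K * eps n `^ (d%:R * ((p - 1) / p))))).
  apply: ler_pM upper; [exact: mulr_ge0 (ltW mK0) (powR_ge0 _ _)|exact: ltW|].
  rewrite (ler_wpM2l (ltW mK0))// ge0_ler_powR ?(ltW t0) ?nnegrE//.
  by rewrite invr_ge0 ltW.
have -> : (eps n)^-1 = eps n `^ -1 by rewrite powR_inv1// ltW.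
rewrite -powRrM.
rewrite [leLHS](_ : _ = m * (eps n `^ (-1 * t) * eps n `^ (d%:R * ((p - 1) / p)))); last first.
  by field; rewrite gt_eqF.
rewrite -powRD ?(gt_eqF (eps0 n)) ?implybT//.
by rewrite (_ : -1 * t + _ = d%:R * s)// /t; ring.
Qed.
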